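(* Let $n\in\mathbb N$ and let $\Phi=\{\varphi_m\}_{m=1}^\infty$ be a family of nondecreasing continuous functions $\varphi_m:[0,\infty)\to\mathbb R$ such that for each $m\in\mathbb N$: ($i_1$) $\lim_{x\to+\infty}\varphi_m(x)/x=+\infty$; ($i_2$) for each $A>0$ there is a constant $C(m,A)>0$ with $\varphi_m(x)+A\ln(1+x)\le\varphi_{m+1}(x)+C(m,A)$ for all $x\ge0$; ($i_3$) there is a constant $a_m>0$ such that $\varphi_m(2x)\le\varphi_{m+1}(x)+a_m$ for all $x\ge 0$. Then $E(\Phi)=\mathcal H(\Phi)$ (equality of topological vector spaces).
   Context: $\|\cdot\|$ is the Euclidean norm on $\mathbb R^n$ or $\mathbb C^n$; $H(\mathbb C^n)$ is the space of entire functions on $\mathbb C^n$. For $\nu\in\mathbb N$, $k\in\mathbb Z_+$ let $$E_k(\varphi_\nu)=\Big\{f\in H(\mathbb C^n):\ p_{\nu,k}(f)=\sup_{z\in\mathbb C^n}\frac{|f(z)|(1+\|z\|)^k}{e^{\varphi_\nu(\|\operatorname{Im}z\|)}}<\infty\Big\}.$$ $E(\varphi_\nu)=\bigcap_{k=0}^\infty E_k(\varphi_\nu)$ has the projective limit topology (defined by the norms $p_{\nu,k}$, $k\in\mathbb Z_+$), and $E(\Phi)=\bigcup_{\nu=1}^\infty E(\varphi_\nu)$ has the (locally convex) inductive limit topology of the spaces $E(\varphi_\nu)$. For a continuous $g:[0,\infty)\to\mathbb R$ with $g(x)/x\to+\infty$ as $x\to+\infty$, the Young conjugate is $g^*(x)=\sup_{y\ge0}(xy-g(y))$,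 $x\ge0$. Put $\psi_\nu(x)=\varphi_\nu(e^x)$ for $x\ge0$; $(\psi_\nu^* )^*$ is the Young conjugate of $\psi_\nu^*$. For $\nu\in\mathbb N$, $k\in\mathbb Z_+$ let $$\mathcal H_k(\varphi_\nu)=\Big\{f\in H(\mathbb C^n):\ \mathcal N_{\nu,k}(f)=\sup_{z\in\mathbb C^n}\frac{|f(z)|(1+\|z\|)^k}{e^{(\psi_\nu^* )^*(\ln(1+\|\operatorname{Im}z\|))}}<\infty\Big\}.$$ $\mathcal H(\varphi_\nu)=\bigcap_{k=0}^\infty\mathcal H_k(\varphi_\nu)$ has the projective limit topology (defined by the norms $\mathcal N_{\nu,k}$, $k\in\mathbb Z_+$), and $\mathcal H(\Phi)=\bigcup_{\nu=1}^\infty\mathcal H(\varphi_\nu)$ has the (locally convex) inductive limit topology of the spaces $\mathcal H(\varphi_\nu)$. *)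

(* Defs.v *)
From HB Require Import structures.
From mathcomp Require Import all_boot all_order all_algebra.
From mathcomp Require Import complex.
From mathcomp Require Import all_classical all_reals all_analysis.

Set Implicit Arguments.
Unset Strict Implicit.
Unset Printing Implicit Defensive.

Import Order.TTheory GRing.Theory Num.Theory.
Import numFieldNormedType.Exports.

Local Open Scope classical_set_scope.
Local Open Scope ring_scope.

(* A topology on a subset X of the vector space V is represented by the set of
   its open sets, which are subsets of X. *)
Section LocallyConvexTopologies.
Context {R : realType} {K : numFieldType} {V : lmodType K}.

Definition seminorms_open (X : set V) (p : nat -> V -> \bar R) : set (set V) :=
  [set U | U `<=` X /\
    forall f, U f -> exists (k : nat) (e : R), 0 < e /\
      [set g | X g /\ forall j, (j <= k)%N -> (p j (g - f)%R < e%:E)%E] `<=` U].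

(* A linear injection iota of a locally convex space T into V, with image X,
   transports the topology of T to X; every locally convex topology on X arises
   in this way.  If X is the union of the subspaces Xs nu, each with topology
   tau nu, the inductive limit topology is the finest of these topologies for
   which all the inclusions of the Xs nu into X are continuous.  As the finest
   one contains all the others, a set is open for it iff it is open for one of
   them. *)
Definition inductive_limit_open (Xs : nat -> set V)
    (tau : nat -> set (set V)) : set (set V) :=
  [set U | exists (T : tvsType K) (iota : {linear T -> V}),
    [/\ injective iota,
        range iota = \bigcup_nu Xs nu,
        forall nu (A : set T), open A -> tau nu (Xs nu `&` iota @` A)
      & exists2 A : set T, open A & U = iota @` A]].

End LocallyConvexTopologies.

Section WeightedSpaces.
Context {R : realType} {n : nat}.

Definition norm_Rn (x : 'rV[R]_n) : R := Num.sqrt (\sum_i x ord0 i ^+ 2).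

Definition norm_Cn (z : 'rV[R[i]]_n) : R :=
  Num.sqrt (\sum_i Normc.normc (z ord0 i) ^+ 2).

Definition Im_Cn (z : 'rV[R[i]]_n) : 'rV[R]_n := map_mx (@complex.Im R) z.

Definition entire (f : 'rV[R[i]]_n -> R[i]^o) : Prop :=
  forall z, differentiable f z.

(* Taking w = phi_nu gives p_(nu,k); taking w = biconjugate_weight phi_nu, that
   is, the double Young conjugate of psi_nu at ln (1 + t), gives N_(nu,k). *)
Definition weighted_norm (w : R -> R) (k : nat) (f : 'rV[R[i]]_n -> R[i]^o) :
    \bar R :=
  ereal_sup (range (fun z : 'rV[R[i]]_n =>
    (Normc.normc (f z) * (1 + norm_Cn z) ^+ k / expR (w (norm_Rn (Im_Cn z))))%:E)).

Definition weighted_space_k (w : R -> R) (k : nat) :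
    set ('rV[R[i]]_n -> R[i]^o) :=
  [set f | entire f /\ (weighted_norm w k f < +oo)%E].

Definition weighted_space (w : R -> R) : set ('rV[R[i]]_n -> R[i]^o) :=
  \bigcap_k weighted_space_k w k.

Definition weighted_space_open (w : R -> R) :
    set (set ('rV[R[i]]_n -> R[i]^o)) :=
  seminorms_open (weighted_space w) (weighted_norm w).

Definition weighted_union (w : nat -> R -> R) : set ('rV[R[i]]_n -> R[i]^o) :=
  \bigcup_nu weighted_space (w nu).

Definition weighted_union_open (w : nat -> R -> R) :
    set (set ('rV[R[i]]_n -> R[i]^o)) :=
  inductive_limit_open (fun nu => weighted_space (w nu))
                       (fun nu => weighted_space_open (w nu)).

End WeightedSpaces.

Section Spaces.
Context {R : realType}.

Definition young_conjugate (g : R -> R) (x : R) : R :=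
  sup [set x * y - g y | y in [set y | 0 <= y]].

Definition psi (phi : R -> R) (x : R) : R := phi (expR x).

Definition biconjugate_weight (phi : R -> R) (t : R) : R :=
  young_conjugate (young_conjugate (psi phi)) (ln (1 + t)).

Variable n : nat.

(* Families are indexed from 0: phi m is the (m+1)-st member.  Only the values
   of phi m on [0, +oo[ matter. *)
Definition E_Phi (phi : nat -> R -> R) : set ('rV[R[i]]_n -> R[i]^o) :=
  weighted_union phi.

Definition E_Phi_open (phi : nat -> R -> R) :
    set (set ('rV[R[i]]_n -> R[i]^o)) :=
  weighted_union_open phi.

Definition H_Phi (phi : nat -> R -> R) : set ('rV[R[i]]_n -> R[i]^o) :=
  weighted_union (fun nu => biconjugate_weight (phi nu)).

Definition H_Phi_open (phi : nat -> R -> R) :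
    set (set ('rV[R[i]]_n -> R[i]^o)) :=
  weighted_union_open (fun nu => biconjugate_weight (phi nu)).

End Spaces.

Arguments E_Phi {R} n phi _.
Arguments E_Phi_open {R} n phi _.
Arguments H_Phi {R} n phi _.
Arguments H_Phi_open {R} n phi _.

(* Main.v *)
Require Import Defs.
From mathcomp Require Import all_boot all_order all_algebra.
From mathcomp Require Import complex.
From mathcomp Require Import all_classical all_reals all_analysis.
From mathcomp Require Import ring lra.

Set Implicit Arguments.
Unset Strict Implicit.
Unset Printing Implicit Defensive.

Import Order.TTheory GRing.Theory Num.Theory.
Import numFieldNormedType.Exports.

Local Open Scope classical_set_scope.
Local Open Scope ring_scope.

(* The weights phi_nu and psi_nu^** (ln (1 + t)) are not comparable pointwise,
   since psi_nu need not be convex.  One inclusion is nevertheless pointwise: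
   psi^** <= psi gives psi_nu^** (ln (1 + t)) <= phi_nu (1 + t), which (i3)
   bounds by phi_(nu+1) (t) up to a constant.

   For the other one, given z = x + iy with t = |y| > 0, consider the entire
   function g(w) = f(x + w y) of one variable, so that g(i) = f(z).  Its j-th
   Taylor coefficient is bounded by r^-j sup_(|w| = r) |g| for every r > 0.  On
   the circle of radius r = e^s / t the imaginary part of x + w y has norm at
   most e^s, so optimising over s >= 0 bounds the coefficient by
   C t^j exp (- psi^* (j)).  By (i3) there is a spare factor 2^-j, the Taylor
   series at i is thus summable, and its sum is at most
   C' exp (psi_(nu+2)^** (ln (1 + t))); (i2) absorbs the polynomial factors.

   In both directions the k-th norm is controlled by the k-th norm alone, up to
   a shift of nu, so the two inductive systems define the same topology.

   The Cauchy estimates are obtained from Goursat's theorem in the coordinates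
   (s, t), z = exp (s + it), in which circles become vertical segments. *)

(** * Integrals over segments and Goursat's theorem *)

Section Segments.
Context {R : realType}.
Implicit Types (f g : R -> R) (a b : R).

(** Not oriented: the value is 0 when [b < a], so the order of the endpoints is a hypothesis where
    it matters. *)
Definition seg f a b : R := \int[lebesgue_measure]_(x in `[a, b]) f x.

Lemma seg_integrable f a b : {in `[a, b], continuous f} ->
  lebesgue_measure.-integrable `[a, b] (EFin \o f).
Proof.
move=> cf; apply: continuous_compact_integrable; first exact: segment_compact.
by apply: continuous_in_subspaceT => x; rewrite inE => /cf.
Qed.

Lemma seg_split f a b c : a <= c -> c <= b -> {in `[a, b], continuous f} ->
  seg f a b = seg f a c + seg f c b.
Proof.
move=> ac cb cf.
have := @Rintegral_itvB R f (BLeft a) (BRight b) c (seg_integrable cf).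
rewrite !bnd_simp => /(_ ac cb) E; rewrite Rintegral_itv_obnd_cbnd in E.
  by rewrite /seg -E addrC subrK.
apply: (@integrableS _ _ _ lebesgue_measure `[c, b]%classic) => //.
  exact: subset_itv_oc_cc.
apply: seg_integrable => x; rewrite in_itv/= => /andP[cx xb].
by apply: cf; rewrite in_itv/= (le_trans ac cx).
Qed.

Lemma segD f g a b : {in `[a, b], continuous f} -> {in `[a, b], continuous g} ->
  seg (fun x => f x + g x) a b = seg f a b + seg g a b.
Proof. by move=> cf cg; apply: RintegralD => //; exact: seg_integrable. Qed.

Lemma segB f g a b : {in `[a, b], continuous f} -> {in `[a, b], continuous g} ->
  seg (fun x => f x - g x) a b = seg f a b - seg g a b.
Proof. by move=> cf cg; apply: RintegralB => //; exact: seg_integrable. Qed.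

Lemma seg_cst (c : R) a b : a <= b -> seg (fun=> c) a b = c * (b - a).
Proof.
move=> ab; rewrite /seg Rintegral_cst //= lebesgue_measure_itv /= lte_fin.
by case: ltP => // ba; rewrite (@le_anti _ _ a b) ?ab ?ba// subrr.
Qed.

Lemma eq_seg f g a b : (forall x, a <= x <= b -> f x = g x) ->
  seg f a b = seg g a b.
Proof. by move=> fg; apply: eq_Rintegral => x; rewrite inE/= in_itv/= => /fg. Qed.

Lemma seg_bound f a b M : a <= b -> {in `[a, b], continuous f} ->
  (forall x, a <= x <= b -> `|f x| <= M) -> `|seg f a b| <= M * (b - a).
Proof.
move=> ab cf fM; apply: le_trans.
  by apply: le_normr_Rintegral => //; exact: seg_integrable.
rewrite -seg_cst//; apply: le_Rintegral => //.
- apply: (@seg_integrable (fun x => `|f x|)) => x xab.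
  by apply: (@continuous_comp _ _ _ f); [exact: cf|exact: norm_continuous].
- by apply: (@seg_integrable (fun=> M)) => x _; exact: cst_continuous.
Qed.

Lemma in_itv_continuousW f a b a' b' : {in `[a, b], continuous f} ->
  a <= a' -> b' <= b -> {in `[a', b'], continuous f}.
Proof.
move=> cf aa bb x; rewrite in_itv/= => /andP[ax xb]; apply: cf.
by rewrite in_itv/= (le_trans aa ax) (le_trans xb bb).
Qed.

Lemma in_itv_continuousB f g a b : {in `[a, b], continuous f} ->
  {in `[a, b], continuous g} -> {in `[a, b], continuous (fun x => f x - g x)}.
Proof.
move=> cf cg x xab; apply: (@continuousB _ _ _ f g); [exact: cf|exact: cg].
Qed.

End Segments.

(** * Flux through the boundary of a rectangle *)

Section Flux.
Context {R : realType}.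
Implicit Types (P W : R -> R -> R).

Definition expansion2 P (s t p1 p2 : R) := forall e : R, 0 < e ->
  exists2 d : R, 0 < d & forall x y : R, `|x| + `|y| < d ->
    `|P (s + x) (t + y) - P s t - p1 * x - p2 * y| <= e * (`|x| + `|y|).

(** Outward flux of the field [(P, W)] through the boundary of [[a, b] x [al, be]], with opposite
    sides paired under one integral. *)
Definition flux P W (a b al be : R) : R :=
  seg (fun t => P b t - P a t) al be + seg (fun s => W s be - W s al) a b.

Lemma expansion2_continuous P s t p1 p2 : expansion2 P s t p1 p2 ->
  {for s, continuous (fun x => P x t)} /\ {for t, continuous (P s)}.
Proof.
move=> /(_ 1 ltr01)[d d0 Pd].
have H x : `|x| < d -> `|P (s + x) t - P s t| <= (1 + `|p1|) * `|x|.
  move=> xd; have := Pd x 0; rewrite normr0 !addr0 mulr0 subr0 mul1r => /(_ xd).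
  move=> h; rewrite -[_ - _](subrK (p1 * x)) (le_trans (ler_normD _ _))//.
  by rewrite mulrDl mul1r normrM lerD2r.
have H' x : `|x| < d -> `|P s (t + x) - P s t| <= (1 + `|p2|) * `|x|.
  move=> xd; have := Pd 0 x; rewrite normr0 !addr0 add0r mulr0 subr0 mul1r => /(_ xd).
  move=> h; rewrite -[_ - _](subrK (p2 * x)) (le_trans (ler_normD _ _))//.
  by rewrite mulrDl mul1r normrM lerD2r.
have G (F : R -> R) u c : 0 <= c -> (forall x, `|x| < d -> `|F (u + x) - F u| <= (1 + c) * `|x|) ->
    {for u, continuous F}.
  move=> c0 Fu; apply/cvgrPdist_le => e e0.
  have e1 : 0 < e / (1 + c) by rewrite divr_gt0// ltr_pwDl.
  exists (Num.min d (e / (1 + c))); first by rewrite /= lt_min d0.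
  move=> x /=; rewrite distrC lt_min => /andP[xd xe].
  rewrite distrC (_ : F x = F (u + (x - u))); last by rewrite addrC subrK.
  apply: (le_trans (Fu _ xd)).
  by rewrite mulrC -ler_pdivlMr ?ltr_pwDl// ltW.
by split; [apply: (G _ _ _ (normr_ge0 p1))|apply: (G _ _ _ (normr_ge0 p2))].
Qed.

(** The divergence vanishes because [p1] is dP/ds and [- p1] is dW/dt. The expansions hold on full
    neighbourhoods even at boundary points, so on each side the fields are continuous in the
    ordinary sense. *)
Definition divergence_free P W (a b al be : R) := forall s t : R,
  a <= s <= b -> al <= t <= be -> exists p1 p2 w1 : R,
    expansion2 P s t p1 p2 /\ expansion2 W s t w1 (- p1).

Lemma divergence_freeW P W a b al be a' b' al' be' :
  divergence_free P W a b al be -> a <= a' -> b' <= b -> al <= al' -> be' <= be ->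
  divergence_free P W a' b' al' be'.
Proof.
move=> D aa bb ll ee s t /andP[s1 s2] /andP[t1 t2]; apply: D.
  by rewrite (le_trans aa s1) (le_trans s2 bb).
by rewrite (le_trans ll t1) (le_trans t2 ee).
Qed.

Lemma divergence_free_continuous P W a b al be :
  divergence_free P W a b al be -> a <= b -> al <= be ->
  [/\ forall s, a <= s <= b -> {in `[al, be], continuous (P s)} &
      forall t, al <= t <= be -> {in `[a, b], continuous (fun s => W s t)}].
Proof.
move=> D ab le; split=> [s sab t|t tab s]; rewrite in_itv/= => h.
  by have [p1 [p2 [w1 [/expansion2_continuous[]]]]] := D s t sab h.
by have [p1 [p2 [w1 [_ /expansion2_continuous[]]]]] := D s t h tab.
Qed.

(** The two contributions of the common side [s = c] cancel. *)
Lemma flux_split1 P W a b al be c : divergence_free P W a b al be ->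
  a <= c -> c <= b -> al <= be ->
  flux P W a b al be = flux P W a c al be + flux P W c b al be.
Proof.
move=> D ac cb le; have ab := le_trans ac cb.
have [cP cW] := divergence_free_continuous D ab le.
have cPa : {in `[al, be], continuous (P a)} by apply: cP; rewrite lexx.
have cPb : {in `[al, be], continuous (P b)} by apply: cP; rewrite lexx ab.
have cPc : {in `[al, be], continuous (P c)} by apply: cP; rewrite ac cb.
have cWa : {in `[a, b], continuous (fun s => W s al)} by apply: cW; rewrite lexx.
have cWb : {in `[a, b], continuous (fun s => W s be)} by apply: cW; rewrite lexx le.
rewrite /flux !segB //; try by [apply: in_itv_continuousW cWa _ _|apply: in_itv_continuousW cWb _ _].
rewrite (seg_split ac cb cWa) (seg_split ac cb cWb); ring.
Qed.

Lemma flux_split2 P W a b al be c : divergence_free P W a b al be ->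
  a <= b -> al <= c -> c <= be ->
  flux P W a b al be = flux P W a b al c + flux P W a b c be.
Proof.
move=> D ab ac cb; have le := le_trans ac cb.
have [cP cW] := divergence_free_continuous D ab le.
have cPa : {in `[al, be], continuous (P a)} by apply: cP; rewrite lexx.
have cPb : {in `[al, be], continuous (P b)} by apply: cP; rewrite lexx ab.
have cWc : {in `[a, b], continuous (fun s => W s c)} by apply: cW; rewrite ac cb.
have cWa : {in `[a, b], continuous (fun s => W s al)} by apply: cW; rewrite lexx.
have cWb : {in `[a, b], continuous (fun s => W s be)} by apply: cW; rewrite lexx le.
rewrite /flux !segB //; try by [apply: in_itv_continuousW cPa _ _|apply: in_itv_continuousW cPb _ _].
rewrite (seg_split ac cb cPa) (seg_split ac cb cPb); ring.
Qed.

(** Halve in [s], then in [t]: each time one half carries at least half of the flux in absolute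
    value, whence the factor 4. The pair [c] is the lower left corner of the quadrant kept. *)
Lemma flux_quadrant P W a al L H : divergence_free P W a (a + L) al (al + H) ->
  0 <= L -> 0 <= H -> exists c : R * R,
  [/\ a <= c.1 <= a + L / 2, al <= c.2 <= al + H / 2 &
    `|flux P W a (a + L) al (al + H)| <=
      4 * `|flux P W c.1 (c.1 + L / 2) c.2 (c.2 + H / 2)|].
Proof.
move=> D L0 H0.
have half (x y z : R) : x = y + z -> exists b : bool, `|x| <= 2 * `|if b then y else z|.
  move=> ->; case: (leP `|y| `|z|) => yz; [exists false|exists true];
    have := ler_normD y z; lra.
have aL : a + L / 2 + L / 2 = a + L by lra.
have aH : al + H / 2 + H / 2 = al + H by lra.
have [||| b1 B1] := half _ _ _ (@flux_split1 _ _ _ _ _ _ (a + L / 2) D _ _ _); try lra.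
pose c1 := if b1 then a else a + L / 2.
have c1a : a <= c1 <= a + L / 2 by rewrite /c1; case: b1 {B1 c1}; lra.
have E1 : (if b1 then flux P W a (a + L / 2) al (al + H)
   else flux P W (a + L / 2) (a + L) al (al + H)) = flux P W c1 (c1 + L / 2) al (al + H).
  by rewrite /c1; case: b1 {B1 c1 c1a}; rewrite ?aL.
rewrite E1 in B1.
have D1 : divergence_free P W c1 (c1 + L / 2) al (al + H).
  by apply: divergence_freeW D _ _ _ _; lra.
have [||| b2 B2] := half _ _ _ (@flux_split2 _ _ _ _ _ _ (al + H / 2) D1 _ _ _); try lra.
pose c2 := if b2 then al else al + H / 2.
have c2a : al <= c2 <= al + H / 2 by rewrite /c2; case: b2 {B2 c2}; lra.
have E2 : (if b2 then flux P W c1 (c1 + L / 2) al (al + H / 2)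
   else flux P W c1 (c1 + L / 2) (al + H / 2) (al + H)) = flux P W c1 (c1 + L / 2) c2 (c2 + H / 2).
  by rewrite /c2; case: b2 {B2 c2 c2a}; rewrite ?aH.
rewrite E2 in B2.
by exists (c1, c2); split => //=; lra.
Qed.

(** The affine part of the field has divergence [p1 - p1] and hence no flux, so only the remainders
    count. They contribute at most [e * (L + H)] per unit of length on pairs of sides of lengths [H]
    and [L]. *)
Lemma flux_small P W s t p1 p2 w1 e : 0 < e -> expansion2 P s t p1 p2 ->
  expansion2 W s t w1 (- p1) -> exists2 d : R, 0 < d &
  forall a al L H : R, 0 <= L -> 0 <= H -> L + H < d ->
    a <= s <= a + L -> al <= t <= al + H ->
    divergence_free P W a (a + L) al (al + H) ->
    `|flux P W a (a + L) al (al + H)| <= e * (L + H) ^+ 2.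
Proof.
move=> e0 eP eW; have e20 : 0 < e / 2 by lra.
have [d1 d10 P1] := eP _ e20; have [d2 d20 W2] := eW _ e20.
exists (Num.min d1 d2); first by rewrite lt_min d10.
move=> a al L H L0 H0; rewrite lt_min => /andP[Ld1 Ld2] sa ta D.
have aL : a <= a + L by lra.
have aH : al <= al + H by lra.
have [cP cW] := divergence_free_continuous D aL aH.
have absle (x y z : R) : z <= x <= z + y -> forall u, z <= u <= z + y -> `|u - x| <= y.
  by move=> h u hu; rewrite ler_norml; lra.
have P1' x y : a <= x <= a + L -> al <= y <= al + H ->
    `|P x y - P s t - p1 * (x - s) - p2 * (y - t)| <= e / 2 * (L + H).
  move=> xa ya; have := absle _ _ _ sa _ xa; have := absle _ _ _ ta _ ya => h1 h2.
  have := P1 (x - s) (y - t); rewrite ![s + _]addrC ![t + _]addrC !subrK => /(_ ltac:(lra)).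
  by move/le_trans; apply; apply: ler_wpM2l; lra.
have W2' x y : a <= x <= a + L -> al <= y <= al + H ->
    `|W x y - W s t - w1 * (x - s) - (- p1) * (y - t)| <= e / 2 * (L + H).
  move=> xa ya; have := absle _ _ _ sa _ xa; have := absle _ _ _ ta _ ya => h1 h2.
  have := W2 (x - s) (y - t); rewrite ![s + _]addrC ![t + _]addrC !subrK => /(_ ltac:(lra)).
  by move/le_trans; apply; apply: ler_wpM2l; lra.
have cst_c (c : R) (A : interval R) : {in A, continuous (fun=> c)} by move=> x _; exact: cst_continuous.
have cPP : {in `[al, al + H], continuous (fun y => P (a + L) y - P a y)}.
  by apply: in_itv_continuousB; apply: cP => //; lra.
have cWW : {in `[a, a + L], continuous (fun x => W x (al + H) - W x al)}.
  by apply: in_itv_continuousB; [apply: (cW (al + H))|apply: (cW al)] => //; lra.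
(* The subtracted constants are the increments of the affine part; their integrals [p1 * L * H] and
   [- p1 * H * L] cancel. *)
have -> : flux P W a (a + L) al (al + H) =
  seg (fun y => (P (a + L) y - P a y) - p1 * L) al (al + H) +
  seg (fun x => (W x (al + H) - W x al) - (- p1) * H) a (a + L).
  rewrite (segB cPP (cst_c _ _)) (segB cWW (cst_c _ _)) !seg_cst// /flux; ring.
have B1 : `|seg (fun y => (P (a + L) y - P a y) - p1 * L) al (al + H)| <= e * (L + H) * (al + H - al).
  apply: seg_bound => //.
    exact: in_itv_continuousB (cst_c _ _).
  move=> y yH; have h1 := P1' (a + L) y ltac:(lra) yH; have h2 := P1' a y ltac:(lra) yH.
  have := ler_normB (P (a + L) y - P s t - p1 * (a + L - s) - p2 * (y - t)) (P a y - P s t - p1 * (a - s) - p2 * (y - t)).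
  rewrite (_ : _ - _ = P (a + L) y - P a y - p1 * L); last ring.
  lra.
have B2 : `|seg (fun x => (W x (al + H) - W x al) - (- p1) * H) a (a + L)| <= e * (L + H) * (a + L - a).
  apply: seg_bound => //.
    exact: in_itv_continuousB (cst_c _ _).
  move=> y yH; have h1 := W2' y (al + H) yH ltac:(lra); have h2 := W2' y al yH ltac:(lra).
  have := ler_normB (W y (al + H) - W s t - w1 * (y - s) - (- p1) * (al + H - t)) (W y al - W s t - w1 * (y - s) - (- p1) * (al - t)).
  rewrite (_ : _ - _ = W y (al + H) - W y al - (- p1) * H); last ring.
  lra.
apply: (le_trans (ler_normD _ _)).
rewrite (_ : e * (L + H) ^+ 2 = e * (L + H) * (al + H - al) + e * (L + H) * (a + L - a)); last ring.
exact: lerD.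
Qed.

(* Goursat's bisection argument: no continuity of the partial derivatives is
   assumed. *)
Lemma flux_widths_eq0 P W a al L H : 0 <= L -> 0 <= H ->
  divergence_free P W a (a + L) al (al + H) ->
  flux P W a (a + L) al (al + H) = 0.
Proof.
move=> L0 H0 D.
have [step stepP] : exists step : nat -> R * R -> R * R, forall n c,
    divergence_free P W c.1 (c.1 + L / 2 ^+ n) c.2 (c.2 + H / 2 ^+ n) ->
    [/\ c.1 <= (step n c).1 <= c.1 + L / 2 ^+ n.+1,
        c.2 <= (step n c).2 <= c.2 + H / 2 ^+ n.+1 &
      `|flux P W c.1 (c.1 + L / 2 ^+ n) c.2 (c.2 + H / 2 ^+ n)| <= 4 *
      `|flux P W (step n c).1 ((step n c).1 + L / 2 ^+ n.+1)
                 (step n c).2 ((step n c).2 + H / 2 ^+ n.+1)|].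
  have ex (nc : nat * (R * R)) : exists c' : R * R, let n := nc.1 in let c := nc.2 in
    divergence_free P W c.1 (c.1 + L / 2 ^+ n) c.2 (c.2 + H / 2 ^+ n) ->
    [/\ c.1 <= c'.1 <= c.1 + L / 2 ^+ n.+1, c.2 <= c'.2 <= c.2 + H / 2 ^+ n.+1 &
      `|flux P W c.1 (c.1 + L / 2 ^+ n) c.2 (c.2 + H / 2 ^+ n)| <= 4 *
      `|flux P W c'.1 (c'.1 + L / 2 ^+ n.+1) c'.2 (c'.2 + H / 2 ^+ n.+1)|].
    (* Where the field is not divergence free the claim is vacuous and any corner will do; this
       makes the step total, as [choice] requires. *)
    case: nc => n c /=; have [D'|nD] := pselect (divergence_free P W c.1 (c.1 + L / 2 ^+ n) c.2 (c.2 + H / 2 ^+ n)); last by exists c.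
    have p2 : (0 : R) <= 2 ^+ n by rewrite exprn_ge0.
    have [c' [c1 c2 c3]] := flux_quadrant D' (divr_ge0 L0 p2) (divr_ge0 H0 p2).
    exists c' => _; have E x : x / 2 ^+ n.+1 = x / 2 ^+ n / 2 :> R.
      by rewrite exprSr invfM mulrA.
    by rewrite !E.
  have [h hP] := choice ex; by exists (fun n c => h (n, c)) => n c; exact: hP (n, c).
pose c := fix c n := if n is m.+1 then step m (c m) else (a, al).
have p2 n : (0 : R) < 2 ^+ n by rewrite exprn_gt0.
have half n x : x / 2 ^+ n = x / 2 ^+ n.+1 + x / 2 ^+ n.+1 :> R.
  by rewrite exprSr; field; rewrite gt_eqF.
have Dc n : divergence_free P W (c n).1 ((c n).1 + L / 2 ^+ n) (c n).2 ((c n).2 + H / 2 ^+ n).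
  elim: n => [|n IH] /=; first by rewrite expr0 !divr1.
  have [c1 c2 _] := stepP _ _ IH.
  have hL := half n L; have hH := half n H.
  by apply: divergence_freeW IH _ _ _ _; rewrite -/c; lra.
have cS n : [/\ (c n).1 <= (c n.+1).1 <= (c n).1 + L / 2 ^+ n.+1,
   (c n).2 <= (c n.+1).2 <= (c n).2 + H / 2 ^+ n.+1 &
   `|flux P W a (a + L) al (al + H)| <= 4 ^+ n * `|flux P W (c n).1 ((c n).1 + L / 2 ^+ n) (c n).2 ((c n).2 + H / 2 ^+ n)|].
  have [c1 c2 _] := stepP _ _ (Dc n); split => //.
  elim: n {c1 c2} => [|n IH]; first by rewrite /= !expr0 !divr1 mul1r.
  have [_ _ c3] := stepP _ _ (Dc n); apply: (le_trans IH).
  rewrite exprSr -mulrA ler_pM2l ?exprn_gt0//.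
(* Nested intervals: the left ends increase, the right ends decrease, and the supremum of the left
   ends lies in every interval. *)
have limit (u : nat -> R) (M : R) : (forall n, u n <= u n.+1 <= u n + M / 2 ^+ n.+1) -> 0 <= M ->
    exists s, forall n, u n <= s <= u n + M / 2 ^+ n.
  move=> uM M0; have incr n k : u n <= u (n + k)%N.
    elim: k => [|k IH]; rewrite ?addn0// addnS.
    by have := uM (n + k)%N; lra.
  have decr n k : u (n + k)%N + M / 2 ^+ (n + k) <= u n + M / 2 ^+ n.
    elim: k => [|k IH]; rewrite ?addn0// addnS.
    by have := uM (n + k)%N; have := half (n + k)%N M; lra.
  have ub n m : u m <= u n + M / 2 ^+ n.
    have pos k : 0 <= M / 2 ^+ k by rewrite divr_ge0// ltW.
    case: (leqP n m) => nm.
      have := decr n (m - n)%N; rewrite subnKC// => h; have := pos m; lra.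
    have := incr m (n - m)%N; rewrite subnKC ?(ltnW nm)// => h; have := pos n; lra.
  exists (sup (range u)) => n; apply/andP; split.
    by apply: ub_le_sup; [exists (u 0%N + M / 2 ^+ 0) => _ [m _ <-]|exists n].
  by apply: ge_sup; [exists (u 0%N), 0%N|move=> _ [m _ <-]].
have [s sP] := limit (fun n => (c n).1) L (fun n => let: And3 x _ _ := cS n in x) L0.
have [t tP] := limit (fun n => (c n).2) H (fun n => let: And3 _ x _ := cS n in x) H0.
apply/eqP; rewrite -normr_le0; apply/ler_addgt0Pr => e e0; rewrite add0r.
have := sP 0%N; have := tP 0%N; rewrite /= expr0 !divr1 => t0 s0.
have [p1 [q2 [w1 [eP eW]]]] := D s t s0 t0.
(* With tolerance [e / ((L + H) ^ 2 + 1)] the factor [4 ^ n] cancels against the square of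
   [(L + H) / 2 ^ n], which leaves at most [e]. The 1 covers the degenerate case [L = H = 0]. *)
have LH : 0 < (L + H) ^+ 2 + 1 by rewrite ltr_wpDl// sqr_ge0.
have [d d0 small] := flux_small (divr_gt0 e0 LH) eP eW.
have [n nd] : exists n : nat, L / 2 ^+ n + H / 2 ^+ n < d.
  exists (Num.trunc ((L + H) / d)).+1.
  rewrite -mulrDl ltr_pdivrMr// mulrC -ltr_pdivrMr//.
  set N := Num.trunc _; have : (L + H) / d < N.+1%:R by exact: truncnS_gt.
  move=> /lt_le_trans; apply; rewrite -natrX ler_nat ltnW//; exact: ltn_expl.
have [_ _ /le_trans] := cS n; apply.
have := small _ _ _ _ (divr_ge0 L0 (ltW (p2 n))) (divr_ge0 H0 (ltW (p2 n))) nd (sP n) (tP n) (Dc n).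
move=> h; rewrite mulrC -ler_pdivlMr ?exprn_gt0//; apply: (le_trans h).
rewrite -mulrDl exprMn mulrA exprVn (_ : 2 ^+ n ^+ 2 = 4 ^+ n :> R); last first.
  by rewrite -exprM mulnC exprM; congr (_ ^+ _); rewrite -natrX.
rewrite ler_pM2r ?invr_gt0 ?exprn_gt0// mulrAC ler_pdivrMr// ler_pM2l//.
by rewrite lerDl.
Qed.

Lemma flux_eq0 P W a b al be : a <= b -> al <= be ->
  divergence_free P W a b al be -> flux P W a b al be = 0.
Proof.
move=> ab le; have := @flux_widths_eq0 P W a al (b - a) (be - al).
by rewrite !(addrC _ (_ - _)) !subrK !subr_ge0; exact.
Qed.

End Flux.

(** * Complex derivatives and polar coordinates *)

Section ComplexDerivative.
Context {R : realType}.
Local Notation C := R[i].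
Local Notation normc := (@Normc.normc R).
Local Notation Re := (@complex.Re R).
Local Notation Im := (@complex.Im R).
Implicit Types (f g q : C -> C) (w z : C).

Lemma normc_ge0 z : 0 <= normc z.
Proof. by case: z => x y; rewrite sqrtr_ge0. Qed.

Lemma normc_leD w z : normc (w + z) <= normc w + normc z.
Proof. exact: (@le_normcD R w z). Qed.

Lemma normc_opp z : normc (- z) = normc z.
Proof. exact: (@normcN R z). Qed.

Lemma normc_leB w z : normc (w - z) <= normc w + normc z.
Proof. by rewrite (le_trans (normc_leD _ _))// normc_opp. Qed.

Lemma normc_distC w z : normc (w - z) = normc (z - w).
Proof. by rewrite -normc_opp opprB. Qed.

Lemma normc_dist_ge w z : normc w - normc z <= normc (w - z).
Proof. by rewrite lerBlDr (le_trans _ (normc_leD _ _))// subrK. Qed.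

Lemma normc_eq0 z : (normc z == 0) = (z == 0).
Proof.
by apply/eqP/eqP => [/Normc.eq0_normc//|->]; rewrite /= expr0n addr0 sqrtr0.
Qed.

Lemma normc_gt0 z : (0 < normc z) = (z != 0).
Proof. by rewrite lt0r normc_eq0 normc_ge0 andbT. Qed.

Lemma normcX z n : normc (z ^+ n) = normc z ^+ n.
Proof.
elim: n => [|n IH]; last by rewrite !exprS Normc.normcM IH.
by rewrite !expr0 Normc.normc1.
Qed.

Lemma normr_Re z : `|Re z| <= normc z.
Proof. by case: z => x y /=; rewrite -sqrtr_sqr ler_wsqrtr// lerDl sqr_ge0. Qed.

Lemma normr_Im z : `|Im z| <= normc z.
Proof. by case: z => x y /=; rewrite -sqrtr_sqr ler_wsqrtr// lerDr sqr_ge0. Qed.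

Lemma normc_leReIm z : normc z <= `|Re z| + `|Im z|.
Proof.
case: z => x y /=; rewrite -[leRHS]ger0_norm ?addr_ge0//.
rewrite -[leRHS]sqrtr_sqr ler_wsqrtr// sqrrD !real_normK ?num_real//.
by have := mulr_ge0 (normr_ge0 x) (normr_ge0 y); lra.
Qed.

(** Complex differentiability, written with the real-valued modulus because the norm of [C] takes
    its values in [C]. *)
Definition cdiff q w a := forall e : R, 0 < e -> exists2 d : R, 0 < d &
  forall h : C, normc h < d -> normc (q (w + h) - q w - a * h) <= e * normc h.

Definition ccont q w := forall e : R, 0 < e -> exists2 d : R, 0 < d &
  forall h : C, normc h < d -> normc (q (w + h) - q w) <= e.

Lemma cdiff_ccont q w a : cdiff q w a -> ccont q w.
Proof.
move=> /(_ 1 ltr01)[d d0 qd] e e0.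
have c0 : 0 < 1 + normc a by rewrite ltr_pwDl ?normc_ge0.
exists (Num.min d (e / (1 + normc a))); first by rewrite lt_min d0 divr_gt0.
move=> h; rewrite lt_min => /andP[hd he].
rewrite -[_ - q w](subrK (a * h)) (le_trans (normc_leD _ _))//.
rewrite (le_trans (lerD (qd _ hd) (lexx _)))// Normc.normcM -mulrDl.
by rewrite mulrC -ler_pdivlMr// ltW.
Qed.

Lemma derivable_cdiff (q : C^o -> C^o) w : derivable q w 1 -> exists a, cdiff q w a.
Proof.
move=> /cvg_ex[a qa]; exists a => e e0.
have eC : (0 : C) < e%:C%C by rewrite ltcR.
have [d d0 qd] := (@cvgrPdist_le _ _ _ _ _ _ _).1 qa _ eC.
have {}d0 : (0 : C) < d by exact: d0.
(* The radius [d] is an element of [C]; being positive, it is real. *)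
exists (Re d); first by move: d0; rewrite ltcE => /andP[].
move=> h hd; have [->|h0] := eqVneq h 0.
  by rewrite addr0 subrr mulr0 subr0 (eqP (_ : normc 0 == 0)) ?normc_eq0 ?mulr0.
have hd' : `|0 - h| < d.
  move: d0; rewrite ltcE /= => /andP[d0 _].
  by rewrite sub0r normrN ltcE/= d0/=.
have := qd h hd' h0 => /=.
rewrite [h *: 1]mulr1 [h + w]addrC => H.
have {}H : normc (a - h^-1 * (q (w + h) - q w)) <= e by rewrite -lecR.
rewrite (_ : _ - _ = - (h * (a - h^-1 * (q (w + h) - q w)))).
  by rewrite normc_opp Normc.normcM mulrC ler_wpM2r// normc_ge0.
by rewrite mulrBr mulrA divff// mul1r opprB [a * h]mulrC.
Qed.

Lemma cdiff_local q q' w a d : 0 < d -> (forall h, normc h < d -> q (w + h) = q' (w + h)) ->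
  cdiff q w a -> cdiff q' w a.
Proof.
move=> d0 qq' qa e e0; have [d' d'0 H] := qa e e0.
exists (Num.min d d'); first by rewrite lt_min d0.
move=> h; rewrite lt_min => /andP[hd hd']; rewrite -qq'//.
have := qq' 0; rewrite addr0 => <-; first exact: H.
by rewrite (eqP (_ : normc 0 == 0)) ?normc_eq0.
Qed.

(** The point [r e^(it)]; thus [cis (expR s) t] is the complex exponential of [s + it]. *)
Definition cis (r t : R) : C := ((r * cos t) +i* (r * sin t))%C.

Lemma normc_cis r t : normc (cis r t) = `|r|.
Proof. by rewrite /= !exprMn -mulrDr cos2Dsin2 mulr1 sqrtr_sqr. Qed.

Lemma cisM r r' t t' : cis (r * r') (t + t') = cis r t * cis r' t'.
Proof.
rewrite /cis cosD sinD; apply/eqP; rewrite eq_complex /=; apply/andP; split;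
  apply/eqP; ring.
Qed.

Lemma cis2pi r : cis r (pi *+ 2) = cis r 0.
Proof. by rewrite /cis cos2pi sin2pi cos0 sin0. Qed.

Lemma derive_remainder (F : R -> R) (x df : R) : is_derive x 1 F df ->
  forall e, 0 < e -> exists2 d : R, 0 < d & forall h, `|h| < d ->
    `|F (x + h) - F x - df * h| <= e * `|h|.
Proof.
move=> [/cvg_ex[a Fa] Fd] e e0.
have ad : a = df by rewrite -Fd; apply/esym/cvg_lim => //.
rewrite ad in Fa; have /= [d d0 qd] := (@cvgrPdist_le _ _ _ _ _ _ _).1 Fa _ e0.
exists d => // h hd; have [->|h0] := eqVneq h 0.
  by rewrite addr0 subrr mulr0 subr0 normr0 mulr0.
have hd' : `|0 - h| < d by rewrite sub0r normrN.
have := qd h hd' h0 => /=.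
rewrite [h *: 1]mulr1 [h + x]addrC => H.
rewrite (_ : _ - _ = - (h * (df - h^-1 * (F (x + h) - F x)))).
  by rewrite normrN normrM mulrC ler_wpM2r.
by rewrite mulrBr mulrA divff// mul1r opprB [df * h]mulrC.
Qed.

(** The complex exponential has derivative 1 at 0; this is assembled from the real expansions of
    [expR], [sin] and [cos]. *)
Lemma cis_expR_remainder e : 0 < e -> exists2 d : R, 0 < d &
  forall x y : R, `|x| + `|y| < d ->
    normc (cis (expR x) y - 1 - (x +i* y)%C) <= e * (`|x| + `|y|).
Proof.
(* The partial errors below add up to [e'] times the absolute value of [x] plus [8 * e'] times that
   of [y], whence [e / 8]. *)
move=> e0; have [e' [e1 e'1 e'8]] : exists e' : R, [/\ 0 < e', e' <= 1 & e' <= e / 8].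
  by exists (Num.min 1 (e / 8)); rewrite lt_min ltr01 divr_gt0// !ge_min !lexx orbT.
have [d1 d10 H1] := derive_remainder (is_derive_expR 0) e1.
have [d2 d20 H2] := derive_remainder (is_derive_sin 0) e1.
have [d3 d30 H3] := derive_remainder (is_derive_cos 0) e1.
exists (Num.min (Num.min d1 d2) (Num.min d3 e')).
  by rewrite !lt_min d10 d20 d30 e1.
move=> x y; rewrite !lt_min => /andP[/andP[xy1 xy2] /andP[xy3 xy4]].
have {}H1 := H1 x ltac:(move: (normr_ge0 y); lra).
have {}H2 := H2 y ltac:(move: (normr_ge0 x); lra).
have {}H3 := H3 y ltac:(move: (normr_ge0 x); lra).
rewrite !add0r expR0 mul1r in H1; rewrite !add0r sin0 cos0 mul1r subr0 in H2.
rewrite !add0r cos0 sin0 oppr0 mul0r subr0 in H3.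
have x0 := normr_ge0 x; have y0 := normr_ge0 y.
have E1 : `|expR x - 1| <= 2 * `|x|.
  rewrite -[_ - 1](subrK x) (le_trans (ler_normD _ _))//.
  have : e' * `|x| <= 1 * `|x| by rewrite ler_wpM2r.
  lra.
have E2 : `|expR x| <= 3.
  rewrite -[expR x](subrK 1) (le_trans (ler_normD _ _))// normr1.
  have : `|x| <= 1 by lra.
  lra.
rewrite (le_trans (normc_leReIm _))//=.
rewrite (_ : _ - x = expR x * (cos y - 1) + (expR x - 1 - x)); last ring.
rewrite (_ : _ - y = expR x * (sin y - y) + (expR x - 1) * y); last ring.
have A1 : `|expR x * (cos y - 1)| <= 3 * (e' * `|y|).
  by rewrite normrM ler_pM.
have A2 : `|expR x * (sin y - y)| <= 3 * (e' * `|y|).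
  by rewrite normrM ler_pM.
have A3 : `|(expR x - 1) * y| <= 2 * (e' * `|y|).
  rewrite normrM (le_trans (ler_wpM2r y0 E1))// -mulrA ler_pM2l//.
  rewrite ler_wpM2r//; lra.
have B1 : e' * `|x| <= e / 8 * `|x| by rewrite ler_wpM2r.
have B2 : e' * `|y| <= e / 8 * `|y| by rewrite ler_wpM2r.
rewrite (le_trans (lerD (ler_normD _ _) (ler_normD _ _)))//.
have B3 : 0 <= e * `|x| by rewrite mulr_ge0// ltW.
lra.
Qed.

(** Chain rule with the exponential, whose derivative equals its value [w]: hence [b = a * w]. The
    argument of [q] moves by [w * (u - 1)], where [u] is the exponential of [v = x + iy], and
    [u - 1 - v] is controlled by [cis_expR_remainder]. *)
Lemma cdiff_polar q s t a : cdiff q (cis (expR s) t) a ->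
  let b := a * cis (expR s) t in forall e, 0 < e -> exists2 d : R, 0 < d &
  forall x y : R, `|x| + `|y| < d ->
  normc (q (cis (expR (s + x)) (t + y)) - q (cis (expR s) t) - b * (x +i* y)%C)
    <= e * (`|x| + `|y|).
Proof.
move=> qa b e e0; set w := cis _ _ in qa b *.
pose K := normc w; have K0 : 0 < K by rewrite /K normc_cis normr_gt0 gt_eqF// expR_gt0.
have A0 : 0 <= normc a := normc_ge0 a.
pose e2 := Num.min 1 (e / (2 * (normc b + 1))).
have b0 := normc_ge0 b.
have e20 : 0 < e2 by rewrite lt_min ltr01 divr_gt0//; lra.
have [d1 d10 H1] := cis_expR_remainder e20.
have e10 : 0 < e / (4 * K) by rewrite divr_gt0// mulr_gt0.
have [d2 d20 H2] := qa _ e10.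
exists (Num.min d1 (d2 / (2 * K))); first by rewrite lt_min d10 divr_gt0// mulr_gt0.
move=> x y; rewrite lt_min => /andP[xy1 xy2].
have {}H1 := H1 _ _ xy1; set v := (x +i* y)%C in H1 *; set u := cis _ y in H1.
have v1 : normc v <= `|x| + `|y| by exact: normc_leReIm.
set m := `|x| + `|y| in xy1 xy2 H1 v1 *.
have m0 : 0 <= m by rewrite addr_ge0.
have e2m : e2 * m <= m by rewrite ler_piMl// ge_min lexx.
have hm : normc (u - 1) <= 2 * m.
  by rewrite -[u - 1](subrK v) (le_trans (normc_leD _ _))//; lra.
rewrite expRD cisM -/w -/u (_ : w * u = w + w * (u - 1)); last ring.
have hd : normc (w * (u - 1)) < d2.
  rewrite Normc.normcM -/K; move: xy2; rewrite ltr_pdivlMr ?mulr_gt0// => xy2.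
  by apply: le_lt_trans xy2; rewrite [leRHS](_ : _ = K * (2 * m)) ?ler_pM2l//; ring.
have {}H2 := H2 _ hd.
rewrite (_ : _ - _ = (q (w + w * (u - 1)) - q w - a * (w * (u - 1))) + b * (u - 1 - v)); last by rewrite /b; ring.
rewrite (le_trans (normc_leD _ _))// Normc.normcM.
have B1 : e / (4 * K) * normc (w * (u - 1)) <= e / 2 * m.
  rewrite Normc.normcM -/K (_ : _ * _ = e / 4 * normc (u - 1)).
    rewrite (_ : e / 2 * m = e / 4 * (2 * m)); last by field.
    by rewrite ler_pM2l// divr_gt0.
  by field; rewrite gt_eqF.
have B2 : normc b * normc (u - 1 - v) <= e / 2 * m.
  apply: (@le_trans _ _ ((normc b + 1) * (e2 * m))).
    by apply: ler_pM => //; [exact: normc_ge0|lra].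
  rewrite mulrA ler_wpM2r// mulrC -ler_pdivlMr; last lra.
  by rewrite /e2 ge_min invfM mulrA lexx orbT.
lra.
Qed.

End ComplexDerivative.

(** * Integrals over circles *)

Section CircleIntegrals.
Context {R : realType}.
Local Notation C := R[i].
Local Notation normc := (@Normc.normc R).
Local Notation Re := (@complex.Re R).
Local Notation Im := (@complex.Im R).
Local Notation tau := (pi *+ 2 : R).
Implicit Types (f g q : C -> C) (w z : C).

(** For [r > 0] this is the contour integral of [q(w) / (iw) dw] over the circle of radius [r], that
    is, 2 pi times the mean of [q] on it. *)
Definition circ q (r : R) : C :=
  (seg (fun t => Re (q (cis r t))) 0 tau +i* seg (fun t => Im (q (cis r t))) 0 tau)%C.

Definition ccont_on q (r : R) := forall w, normc w = r -> ccont q w.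

Lemma tau_gt0 : 0 < tau.
Proof. by rewrite mulrn_wgt0 ?pi_gt0. Qed.

(** Cauchy-Riemann: the real part of [b * (x + iy)] is [Re b * x - Im b * y]. *)
Lemma expansion2_Re q s t a b : (forall e, 0 < e -> exists2 d : R, 0 < d &
    forall x y : R, `|x| + `|y| < d ->
    normc (q (cis (expR (s + x)) (t + y)) - q (cis (expR s) t) - b * (x +i* y)%C)
    <= e * (`|x| + `|y|)) -> a = - Im b ->
  expansion2 (fun s t => Re (q (cis (expR s) t))) s t (Re b) a.
Proof.
move=> qb -> e e0; have [d d0 H] := qb e e0; exists d => // x y xy.
apply: le_trans (H x y xy); apply: le_trans (normr_Re _).
case: (q (cis (expR (s + x)) _)) => ? ?; case: (q _) => ? ?; case: (b) => ? ? /=.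
by rewrite le_eqVlt; apply/orP; left; apply/eqP; congr `|_|; ring.
Qed.

Lemma expansion2_Im q s t b : (forall e, 0 < e -> exists2 d : R, 0 < d &
    forall x y : R, `|x| + `|y| < d ->
    normc (q (cis (expR (s + x)) (t + y)) - q (cis (expR s) t) - b * (x +i* y)%C)
    <= e * (`|x| + `|y|)) ->
  expansion2 (fun s t => Im (q (cis (expR s) t))) s t (Im b) (Re b).
Proof.
move=> qb e e0; have [d d0 H] := qb e e0; exists d => // x y xy.
apply: le_trans (H x y xy); apply: le_trans (normr_Im _).
case: (q (cis (expR (s + x)) _)) => ? ?; case: (q _) => ? ?; case: (b) => ? ? /=.
by rewrite le_eqVlt; apply/orP; left; apply/eqP; congr `|_|; ring.
Qed.

Lemma expansion2N P s t p1 p2 : expansion2 P s t p1 p2 ->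
  expansion2 (fun s t => - P s t : R) s t (- p1) (- p2).
Proof.
move=> Pp e e0; have [d d0 H] := Pp e e0; exists d => // x y xy.
apply: le_trans (H x y xy).
rewrite (_ : _ - - p2 * y = - (P (s + x) (t + y) - P s t - p1 * x - p2 * y)).
  by rewrite normrN.
by ring.
Qed.

(* With z = exp (s + it) the Cauchy-Riemann equations say that the fields
   (Im q, Re q) and (Re q, - Im q) in the variables (s, t) are divergence free;
   by periodicity only the flux through the sides s = cst remains. *)
Lemma circ_annulus q r1 r2 : 0 < r1 -> r1 <= r2 ->
  (forall w, r1 <= normc w <= r2 -> exists a, cdiff q w a) -> circ q r1 = circ q r2.
Proof.
move=> r10 r12 qd; have r20 := lt_le_trans r10 r12.
pose P s t := Re (q (cis (expR s) t)); pose W s t := Im (q (cis (expR s) t)).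
have ln12 : ln r1 <= ln r2 by rewrite ler_ln.
have tau0 := ltW tau_gt0.
have qb s t : ln r1 <= s <= ln r2 -> exists b, forall e, 0 < e ->
    exists2 d : R, 0 < d & forall x y : R, `|x| + `|y| < d ->
    normc (q (cis (expR (s + x)) (t + y)) - q (cis (expR s) t) - b * (x +i* y)%C)
    <= e * (`|x| + `|y|).
  move=> /andP[s1 s2]; have [] := qd (cis (expR s) t).
    by rewrite normc_cis ger0_norm ?expR_ge0// -[r1]lnK ?posrE// -[r2]lnK ?posrE// !ler_expR s1 s2.
  by move=> a /cdiff_polar qa; exists (a * cis (expR s) t).
have DW : divergence_free W P (ln r1) (ln r2) 0 tau.
  move=> s t st _; have [b Hb] := qb s t st; exists (Im b), (Re b), (Re b).
  by split; [exact: expansion2_Im|exact: expansion2_Re].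
have DP : divergence_free P (fun s t => - W s t) (ln r1) (ln r2) 0 tau.
  move=> s t st _; have [b Hb] := qb s t st; exists (Re b), (- Im b), (- Im b).
  by split; [exact: expansion2_Re|apply: expansion2N; exact: expansion2_Im].
have side (F : R -> R -> R) : (forall s, F s tau = F s 0) ->
    seg (fun s => F s tau - F s 0) (ln r1) (ln r2) = 0.
  move=> F0; rewrite (@eq_seg _ _ (fun=> 0)) ?seg_cst ?mul0r// => s _.
  by rewrite F0 subrr.
have eqW := flux_eq0 ln12 tau0 DW; have eqP' := flux_eq0 ln12 tau0 DP.
rewrite /flux (side P) in eqW; last by move=> s; rewrite /P cis2pi.
rewrite /flux (side (fun s t => - W s t)) in eqP'; last by move=> s; rewrite /W cis2pi.
have [cW _] := divergence_free_continuous DW ln12 tau0.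
have [cP _] := divergence_free_continuous DP ln12 tau0.
rewrite segB in eqW; [|by apply: cW; rewrite lexx ln12..].
rewrite segB in eqP'; [|by apply: cP; rewrite lexx ln12..].
move/eqP: eqW; move/eqP: eqP'; rewrite !addr0 !subr_eq0 => /eqP eP /eqP eW.
rewrite /P /W !lnK ?posrE// in eP eW.
by rewrite /circ eP eW.
Qed.

Lemma cis_continuous r t e : 0 < e -> exists2 d : R, 0 < d &
  forall r' t', `|r' - r| < d -> `|t' - t| < d -> normc (cis r' t' - cis r t) < e.
Proof.
move=> e0; pose e1 := e / (4 * (1 + `|r|)).
have r0 := normr_ge0 r; have e10 : 0 < e1 by rewrite divr_gt0// mulr_gt0//; lra.
have [d1 d10 H1] := (@cvgrPdist_le _ _ _ _ _ _ _).1 (continuous_cos (x := t)) _ e10.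
have [d2 d20 H2] := (@cvgrPdist_le _ _ _ _ _ _ _).1 (continuous_sin (x := t)) _ e10.
exists (Num.min (Num.min d1 d2) (e / 8)).
  by rewrite !lt_min d10 d20 divr_gt0.
move=> r' t'; rewrite !lt_min => /andP[_ hr] /andP[/andP[h1 h2] _].
have {}H1 : `|cos t' - cos t| <= e1 by rewrite distrC; apply: H1 => /=; rewrite distrC.
have {}H2 : `|sin t' - sin t| <= e1 by rewrite distrC; apply: H2 => /=; rewrite distrC.
rewrite (le_lt_trans (normc_leReIm _))//=.
rewrite (_ : _ - r * cos t = (r' - r) * cos t' + r * (cos t' - cos t)); last ring.
rewrite (_ : _ - r * sin t = (r' - r) * sin t' + r * (sin t' - sin t)); last ring.
apply: (le_lt_trans (lerD (ler_normD _ _) (ler_normD _ _))); rewrite !normrM.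
have A1 : `|r' - r| * `|cos t'| <= `|r' - r|.
  by rewrite ler_piMr// ler_norml cos_geN1 cos_le1.
have A2 : `|r' - r| * `|sin t'| <= `|r' - r|.
  by rewrite ler_piMr// ler_norml sin_geN1 sin_le1.
have B1 : `|r| * `|cos t' - cos t| <= `|r| * e1 by rewrite ler_wpM2l.
have B2 : `|r| * `|sin t' - sin t| <= `|r| * e1 by rewrite ler_wpM2l.
have B3 : `|r| * e1 <= e / 4.
  rewrite /e1 mulrA ler_pdivrMr; last lra.
  have : 0 <= `|r| * e by rewrite mulr_ge0// ltW.
  lra.
lra.
Qed.

Lemma ccont_cis q r t : ccont q (cis r t) -> forall e, 0 < e ->
  exists2 d : R, 0 < d & forall r' t', `|r' - r| < d -> `|t' - t| < d ->
    normc (q (cis r' t') - q (cis r t)) <= e.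
Proof.
move=> qc e e0; have [d d0 H] := qc e e0.
have [d' d'0 H'] := cis_continuous r t d0; exists d' => // r' t' hr ht.
have := H _ (H' _ _ hr ht).
by rewrite [X in q X]addrC subrK.
Qed.

Lemma ccont_on_continuous q r : 0 <= r -> ccont_on q r -> forall t : R,
  {for t, continuous (fun t => Re (q (cis r t)))} /\
  {for t, continuous (fun t => Im (q (cis r t)))}.
Proof.
move=> r0 qc t; have := ccont_cis (qc (cis r t) _) => /(_ ltac:(by rewrite normc_cis ger0_norm)) H.
split; apply/cvgrPdist_le => e e0; have [d d0 Hd] := H e e0;
    exists d => //= t' tt'; rewrite distrC;
    have {}Hd := Hd r t' ltac:(by rewrite subrr normr0) ltac:(by rewrite distrC);
    apply: le_trans Hd.
  by apply: le_trans (normr_Re _); case: (q _) => ? ?; case: (q _).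
by apply: le_trans (normr_Im _); case: (q _) => ? ?; case: (q _).
Qed.

Lemma eq_circ q q' r : 0 <= r -> (forall w, normc w = r -> q w = q' w) ->
  circ q r = circ q' r.
Proof.
move=> r0 qq'; rewrite /circ; congr (_ +i* _)%C; apply: eq_seg => t _; rewrite qq'//;
  by rewrite normc_cis ger0_norm.
Qed.

Lemma circD q q' r : 0 <= r -> ccont_on q r -> ccont_on q' r ->
  circ (fun w => q w + q' w) r = circ q r + circ q' r.
Proof.
move=> r0 qc qc'; have H := ccont_on_continuous r0 qc; have H' := ccont_on_continuous r0 qc'.
have E (z z' : C) : Re (z + z') = Re z + Re z' /\ Im (z + z') = Im z + Im z' by case: z; case: z'.
apply/eqP; rewrite eq_complex /=; apply/andP; split; apply/eqP.
  rewrite -segD; [|by move=> t _; have [] := H t|by move=> t _; have [] := H' t].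
  by apply: eq_seg => t _; have [] := E (q (cis r t)) (q' (cis r t)).
rewrite -segD; [|by move=> t _; have [] := H t|by move=> t _; have [] := H' t].
by apply: eq_seg => t _; have [] := E (q (cis r t)) (q' (cis r t)).
Qed.

Lemma circ_cst (c : C) r : circ (fun=> c) r = tau%:C%C * c.
Proof.
rewrite /circ !seg_cst ?(ltW tau_gt0)// subr0.
apply/eqP; rewrite eq_complex; case: c => x y /=; apply/andP; split; apply/eqP; ring.
Qed.

Lemma circ_bound q r M : 0 <= r -> ccont_on q r ->
  (forall w, normc w = r -> normc (q w) <= M) -> normc (circ q r) <= 2 * tau * M.
Proof.
move=> r0 qc qM; have H := ccont_on_continuous r0 qc.
rewrite (le_trans (normc_leReIm _))//=.
have nc t : normc (cis r t) = r by rewrite normc_cis ger0_norm.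
have A : `|seg (fun t => Re (q (cis r t))) 0 tau| <= M * (tau - 0).
  apply: seg_bound; first exact: ltW tau_gt0.
    by move=> t _; have [] := H t.
  by move=> t _; apply: le_trans (normr_Re _) (qM _ _).
have B : `|seg (fun t => Im (q (cis r t))) 0 tau| <= M * (tau - 0).
  apply: seg_bound; first exact: ltW tau_gt0.
    by move=> t _; have [] := H t.
  by move=> t _; apply: le_trans (normr_Im _) (qM _ _).
rewrite (le_trans (lerD A B))// subr0 le_eqVlt; apply/orP; left; apply/eqP; ring.
Qed.

(* Uniform continuity on the circle, by compactness of [0, 2 pi]. *)
Lemma circ_continuous q r : 0 <= r -> (forall w, ccont q w) -> forall e, 0 < e ->
  exists2 d : R, 0 < d & forall r', 0 <= r' -> `|r' - r| < d ->
    normc (circ q r' - circ q r) <= e.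
Proof.
move=> r0 qc e e0; have tau0 := tau_gt0.
pose e1 := e / (2 * tau); have e10 : 0 < e1 by rewrite divr_gt0// mulr_gt0.
have /compact_near_coveringP cpt := @segment_compact R 0 tau.
have := cpt R (nbhs r) (fun r' t => normc (q (cis r' t) - q (cis r t)) <= e1) (nbhs_filter r).
case.
  move=> t _; have e20 : 0 < e1 / 2 by lra.
  have [d d0 H] := ccont_cis (qc (cis r t)) e20.
  exists (ball t d, ball r d); first by split; exact: nbhsx_ballx.
  move=> [t' r'] /= [ht hr].
  have A := H r' t' ltac:(by rewrite distrC) ltac:(by rewrite distrC).
  have B := H r t' ltac:(by rewrite subrr normr0) ltac:(by rewrite distrC).
  rewrite (_ : _ - _ = (q (cis r' t') - q (cis r t)) - (q (cis r t') - q (cis r t))); last ring.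
  by rewrite (le_trans (normc_leB _ _))//; lra.
move=> d d0 H; exists d => // r' r'0 hr.
have {}H : forall t, 0 <= t <= tau -> normc (q (cis r' t) - q (cis r t)) <= e1.
  by move=> t ht; apply: (H r') => /=; rewrite 1?distrC// in_itv.
have cr' := @ccont_on_continuous q r' r'0 (fun w _ => qc w).
have cr := @ccont_on_continuous q r r0 (fun w _ => qc w).
rewrite (le_trans (normc_leReIm _))//=.
have A : `|seg (fun t => Re (q (cis r' t)) - Re (q (cis r t))) 0 tau| <= e1 * (tau - 0).
  apply: seg_bound; first exact: ltW.
    by apply: in_itv_continuousB => t _; [have [] := cr' t|have [] := cr t].
  move=> t ht; apply: le_trans (H t ht); apply: le_trans (normr_Re _).
  by case: (q _) => ? ?; case: (q _).
have B : `|seg (fun t => Im (q (cis r' t)) - Im (q (cis r t))) 0 tau| <= e1 * (tau - 0).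
  apply: seg_bound; first exact: ltW.
    by apply: in_itv_continuousB => t _; [have [] := cr' t|have [] := cr t].
  move=> t ht; apply: le_trans (H t ht); apply: le_trans (normr_Im _).
  by case: (q _) => ? ?; case: (q _).
rewrite segB in A; [|by move=> t _; have [] := cr' t|by move=> t _; have [] := cr t].
rewrite segB in B; [|by move=> t _; have [] := cr' t|by move=> t _; have [] := cr t].
apply: (le_trans (lerD A B)); rewrite subr0 le_eqVlt; apply/orP; left; apply/eqP.
rewrite (_ : _ + _ = e1 * (2 * tau)); last ring.
by rewrite /e1 divfK// gt_eqF// mulr_gt0.
Qed.

End CircleIntegrals.

(** * Cauchy estimates *)

Section EntireBound.
Context {R : realType}.
Local Notation C := R[i].
Local Notation normc := (@Normc.normc R).
Local Notation tau := (pi *+ 2 : R).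
Implicit Types (f g q : C -> C) (w z : C).

Lemma normc_le_eq0 z : (forall e, 0 < e -> normc z <= e) -> z = 0.
Proof.
move=> ze; apply/eqP; rewrite -normc_eq0 eq_le normc_ge0 andbT.
by apply/ler_addgt0Pr => e e0; rewrite add0r ze.
Qed.

Lemma ccontD f g w : ccont f w -> ccont g w -> ccont (fun z => f z + g z) w.
Proof.
move=> fc gc e e0; have e20 : 0 < e / 2 by rewrite divr_gt0.
have [d1 d10 H1] := fc _ e20; have [d2 d20 H2] := gc _ e20.
exists (Num.min d1 d2); first by rewrite lt_min d10.
move=> h; rewrite lt_min => /andP[/H1 h1 /H2 h2].
rewrite opprD addrACA (le_trans (normc_leD _ _))//.
by rewrite (le_trans (lerD h1 h2))// -splitr.
Qed.

(* The mean is constant for 0 < r < |p| and for r > |p|; continuity in r glues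
   these pieces with each other and with r = 0, so nothing has to be known about
   q at p beyond continuity. *)
Lemma mean_value q p r : (forall w, ccont q w) ->
  (forall w, w != p -> exists a, cdiff q w a) -> 0 <= r ->
  circ q r = tau%:C%C * q 0.
Proof.
move=> qc qd r0; have p0 := normc_ge0 p.
(* Passage to the limit: by continuity in the radius, a value taken at radii arbitrarily close to
   [r1] is also taken at [r1]. *)
have closed r1 c : 0 <= r1 -> (forall d : R, 0 < d ->
    exists r', [/\ 0 <= r', `|r' - r1| < d & circ q r' = c]) -> circ q r1 = c.
  move=> r10 H; apply/eqP; rewrite -subr_eq0; apply/eqP/normc_le_eq0 => e e0.
  have [d d0 Hd] := circ_continuous r10 qc e0; have [r' [r'0 r'1 <-]] := H d d0.
  by rewrite normc_distC; exact: Hd.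
have E0 : circ q 0 = tau%:C%C * q 0.
  rewrite -(circ_cst (q 0) 0); apply: eq_circ => // w /eqP.
  by rewrite normc_eq0 => /eqP->.
(* Both radii lie on the same side of the modulus of [p], so the closed annulus between them avoids
   [p]. *)
have anti r1 r2 : 0 < r1 -> r1 <= r2 -> (r2 < normc p) || (normc p < r1) ->
    circ q r1 = circ q r2.
  move=> r10 r12 rp; apply: circ_annulus => // w /andP[w1 w2]; apply: qd.
  apply/eqP => wp; move: rp w1 w2; rewrite wp => /orP[]; lra.
have inside r1 : 0 < r1 -> r1 < normc p -> circ q r1 = circ q 0.
  move=> r10 r1p; apply/esym/closed => // d d0; exists (Num.min r1 (d / 2)).
  have m0 : 0 < Num.min r1 (d / 2) by rewrite lt_min r10 divr_gt0.
  split; first exact: ltW.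
    rewrite subr0 gtr0_norm// (@le_lt_trans _ _ (d / 2))//; last lra.
    by rewrite ge_min lexx orbT.
  by apply: anti => //; rewrite ?r1p// ge_min lexx.
have on : circ q (normc p) = circ q 0.
  have [<-//|pN0] := eqVneq 0 (normc p).
  have {}p0 : 0 < normc p by rewrite lt_neqAle pN0.
  apply: closed => [|d d0]; first exact: ltW.
  have m0 : 0 < Num.min d (normc p) by rewrite lt_min d0.
  have md : Num.min d (normc p) <= d by rewrite ge_min lexx.
  have mp : Num.min d (normc p) <= normc p by rewrite ge_min lexx orbT.
  exists (normc p - Num.min d (normc p) / 2); split; first lra.
    by rewrite ltr_norml; lra.
  by apply: inside; lra.
rewrite -E0; have [rp|rp|->//] := ltgtP r (normc p).
  have [<-//|rN0] := eqVneq 0 r; apply: inside => //.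
  by rewrite lt_neqAle rN0.
rewrite -on; apply/esym/closed => // d d0.
have m0 : 0 < Num.min d (r - normc p) by rewrite lt_min d0 subr_gt0.
have md : Num.min d (r - normc p) <= d by rewrite ge_min lexx.
have mp : Num.min d (r - normc p) <= r - normc p by rewrite ge_min lexx orbT.
exists (normc p + Num.min d (r - normc p) / 2); split; first lra.
  by rewrite ltr_norml; lra.
apply: anti; [lra|lra|]; apply/orP; right; lra.
Qed.

Lemma derivable_inv_sub (c w : C) : w != c ->
  derivable (fun z : C^o => (z - c)^-1 : C^o) w 1.
Proof.
move=> wc; apply: (@derivableV C C^o (fun z => z - c)); first by rewrite subr_eq0.
by apply: (@derivableB C C^o C^o id (cst c)); [exact: derivable_id|exact: derivable_cst].
Qed.

Lemma derivable_exp (f : C^o -> C^o) (w : C) n : derivable f w 1 ->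
  derivable (fun z : C^o => f z ^+ n : C^o) w 1.
Proof.
move=> fd; elim: n => [|n IH].
  rewrite (_ : (fun z => _) = cst 1); first exact: derivable_cst.
  by apply/funext => z; rewrite expr0.
rewrite (_ : (fun z => _) = (fun z => f z * f z ^+ n)); last first.
  by apply/funext => z; rewrite exprS.
exact (@derivableM C C^o f (fun z => f z ^+ n) w 1 fd IH).
Qed.

(** The difference quotient is extended to [c] by the derivative. The extra factor [w] makes the
    function vanish at 0, which gives it mean 0 in the proof of Cauchy's formula below. *)
Lemma slope_ccont g c a : cdiff g c a ->
  ccont (fun w => if w == c then a * c else (g w - g c) / (w - c) * w) c.
Proof.
move=> ga e e0; have c0 := normc_ge0 c; have a0 := normc_ge0 a.
have e10 : 0 < e / (2 * (1 + normc c)) by rewrite divr_gt0// mulr_gt0//; lra.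
have [d d0 H] := ga _ e10.
have e20 : 0 < e / (2 * (1 + normc a)) by rewrite divr_gt0// mulr_gt0//; lra.
exists (Num.min (Num.min d 1) (e / (2 * (1 + normc a)))).
  by rewrite !lt_min d0 ltr01.
move=> h; rewrite !lt_min eqxx => /andP[/andP[hd h1] he].
have [->|h0] := eqVneq h 0.
  by rewrite addr0 eqxx subrr (eqP (_ : normc 0 == 0)) ?normc_eq0// ltW.
rewrite -subr_eq0 [X in X == 0]addrC addKr (negbTE h0).
rewrite [X in _ / X]addrC addKr.
rewrite (_ : _ - a * c = (g (c + h) - g c - a * h) / h * (c + h) + a * h); last by field.
rewrite (le_trans (normc_leD _ _))// !Normc.normcM Normc.normcV.
have A : normc (g (c + h) - g c - a * h) / normc h <= e / (2 * (1 + normc c)).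
  by rewrite ler_pdivrMr ?normc_gt0//; exact: H.
have B : normc (c + h) <= 1 + normc c.
  by rewrite (le_trans (normc_leD _ _))//; lra.
have A' : normc (g (c + h) - g c - a * h) / normc h * normc (c + h) <= e / 2.
  rewrite [leRHS](_ : _ = e / (2 * (1 + normc c)) * (1 + normc c)).
    by apply: ler_pM => //; rewrite ?divr_ge0 ?normc_ge0.
  by field; rewrite gt_eqF//; lra.
have B' : normc a * normc h <= e / 2.
  apply: (@le_trans _ _ ((1 + normc a) * (e / (2 * (1 + normc a))))).
    by apply: ler_pM; rewrite ?normc_ge0//; lra.
  rewrite le_eqVlt; apply/orP; left; apply/eqP; field; rewrite gt_eqF//; lra.
lra.
Qed.

(** Cauchy's estimates. In Cauchy's formula on the circle of radius 2, [w / (w - c)] is expanded in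
    powers of [c / w]. The integral of [A k] is 2 pi times the k-th Taylor term of [g] at [c]; moved
    to the circle given by the hypothesis for [k], it is bounded by a multiple of [D / 2 ^ k]. The
    bound [S] only makes the remainder [Q N] tend to 0. In the factor 4, one 2 comes from
    [circ_bound] and the other from the geometric series. *)
Lemma entire_bound (g : C^o -> C^o) (c : C) (D S : R) :
  (forall w, derivable g w 1) -> normc c = 1 ->
  (forall w, normc w = 2 -> normc (g w) <= S) ->
  (forall k, exists2 r : R, 0 < r & forall w, normc w = r ->
    normc (g w) <= D * (r / 2) ^+ k) ->
  normc (g c) <= 4 * D.
Proof.
move=> gd c1 gS gD; have tau0 := tau_gt0 (R := R).
pose A k w := g w * (c * w^-1) ^+ k.
pose B w := g c * c * (w - c)^-1.
pose Q k w := g w * (c * w^-1) ^+ k * (w * (w - c)^-1).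
have dV w : w != 0 -> derivable (fun z : C^o => c * z^-1 : C^o) w 1.
  move=> w0; apply: (@derivableM C C^o (cst c) (fun z => z^-1)); first exact: derivable_cst.
  by apply: (@derivableV C C^o id) => //; exact: derivable_id.
have dA k w : w != 0 -> derivable (A k : C^o -> C^o) w 1.
  move=> w0; apply: (@derivableM C C^o g (fun z => (c * z^-1) ^+ k)); first exact: gd.
  by apply: derivable_exp; exact: dV.
have dB w : w != c -> derivable (B : C^o -> C^o) w 1.
  move=> wc; apply: (@derivableM C C^o (cst (g c * c)) (fun z => (z - c)^-1)); first exact: derivable_cst.
  exact: derivable_inv_sub.
have dQ k w : w != 0 -> w != c -> derivable (Q k : C^o -> C^o) w 1.
  move=> w0 wc; apply: (@derivableM C C^o (A k) (fun z => z * (z - c)^-1)); first exact: dA.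
  apply: (@derivableM C C^o id (fun z => (z - c)^-1)); first exact: derivable_id.
  exact: derivable_inv_sub.
have nz w (r : R) : 0 < r -> normc w = r -> w != 0 by move=> r0 wr; rewrite -normc_gt0 wr.
have nc w (r : R) : 1 < r -> normc w = r -> w != c.
  by move=> r1 wr; apply/eqP => wc; rewrite wc c1 in wr; lra.
have cont (f : C^o -> C^o) w : derivable f w 1 -> ccont f w.
  by move=> /derivable_cdiff[a /cdiff_ccont].
have cA k : ccont_on (A k) 2 by move=> w w2; apply/cont/dA/(nz _ 2).
have cB r : 1 < r -> ccont_on B r by move=> r1 w wr; apply/cont/dB/(nc _ r).
have cQ k : ccont_on (Q k) 2.
  by move=> w w2; apply/cont/dQ; [apply/(nz _ 2)|apply/(nc _ 2) => //; lra].
(* This rests on [w / (w - c) = 1 + (c / w) * (w / (w - c))]. *)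
have QS k : circ (Q k) 2 = circ (A k) 2 + circ (Q k.+1) 2.
  rewrite -circD//; apply: eq_circ => // w w2; rewrite /Q /A exprSr.
  have w0 : w != 0 by apply/(nz _ 2).
  have wc : w - c != 0 by rewrite subr_eq0; apply/(nc _ 2) => //; lra.
  by set X := (_ ^+ k); field; rewrite wc.
(* Outside the unit disc [B] is holomorphic and decays like [1 / w], so the circle can be enlarged;
   [r] is chosen so that the bound drops below [e]. *)
have B0 : circ B 2 = 0.
  apply: normc_le_eq0 => e e0; pose r := 2 + 2 * tau * normc (g c) / e.
  have r2 : 2 <= r by rewrite lerDl divr_ge0 ?mulr_ge0 ?normc_ge0// ltW.
  rewrite (@circ_annulus _ B 2 r)//; last first.
    by move=> w /andP[w2 _]; apply/derivable_cdiff/dB/(nc _ (normc w)) => //; lra.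
  have r10 : 0 < r - 1 by lra.
  apply: (@le_trans _ _ (2 * tau * (normc (g c) / (r - 1)))).
    apply: circ_bound; [lra|apply: cB; lra|] => w wr.
    rewrite /B !Normc.normcM Normc.normcV c1 mulr1.
    have := normc_dist_ge w c; rewrite wr c1 => h.
    by rewrite ler_wpM2l ?normc_ge0// lef_pV2 ?posrE//; lra.
  rewrite mulrA ler_pdivrMr// -ler_pdivrMl// mulrC /r; lra.
(* Cauchy's formula: off [c], [Q 0] is the sum of [q], the constant [g c] and [B]. The first has
   mean [q 0 = 0], with [c] as the exceptional point, and the last integrates to 0. *)
have Q0 : circ (Q 0%N) 2 = tau%:C%C * g c.
  have [a ga] := derivable_cdiff (gd c).
  pose q w := if w == c then a * c else (g w - g c) / (w - c) * w.
  have qd w : w != c -> exists b, cdiff q w b.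
    move=> wc; have : derivable (fun w : C^o => (g w - g c) / (w - c) * w : C^o) w 1.
      apply: (@derivableM C C^o (fun w => (g w - g c) / (w - c)) id); last exact: derivable_id.
      apply: (@derivableM C C^o (fun w => g w - g c) (fun w => (w - c)^-1)); last exact: derivable_inv_sub.
      by apply: (@derivableB C C^o C^o g (cst (g c))); [exact: gd|exact: derivable_cst].
    move=> /derivable_cdiff[b b0]; exists b.
    apply: (@cdiff_local _ _ _ _ _ (normc (w - c))); last exact: b0.
      by rewrite normc_gt0 subr_eq0.
    move=> h hw; rewrite /q ifF//; apply/negbTE/eqP => E.
    by move: hw; rewrite -E opprD addrA subrr add0r normc_opp ltxx.
  have qc w : ccont q w.
    have [->|wc] := eqVneq w c; first exact: slope_ccont.
    by have [b /cdiff_ccont] := qd w wc.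
  have q0 : q 0 = 0.
    rewrite /q ifF ?mulr0//; apply/negbTE; rewrite eq_sym -normc_eq0 c1; lra.
  transitivity (circ (fun w => (q w + g c) + B w) 2).
    apply: eq_circ => // w w2; have wc : w != c by apply/(nc _ 2) => //; lra.
    rewrite /Q /B /q (negbTE wc) expr0 mulr1.
    by field; rewrite subr_eq0.
  have cc w : ccont (fun=> g c) w.
    by move=> e e0; exists 1 => // h _; rewrite subrr (eqP (_ : normc 0 == 0)) ?normc_eq0// ltW.
  rewrite circD//; [|by move=> w w2; apply: ccontD; [exact: qc|exact: cc]|by apply: cB; lra].
  rewrite circD//.
  by rewrite B0 (mean_value qc qd)// q0 mulr0 add0r addr0 circ_cst.
have bA k : normc (circ (A k) 2) <= 2 * tau * (D / 2 ^+ k).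
  have [r r0 gr] := gD k.
  have -> : circ (A k) 2 = circ (A k) r.
    have dA' r1 r2 : 0 < r1 -> forall w, r1 <= normc w <= r2 -> exists a, cdiff (A k) w a.
      by move=> r10 w /andP[w1 _]; apply/derivable_cdiff/dA; rewrite -normc_gt0; lra.
    by have [r2|r2] := leP r 2; [apply/esym|]; apply: circ_annulus => //; [exact: dA'|exact: ltW|exact: dA'].
  apply: circ_bound; [exact: ltW|by move=> w wr; apply/cont/dA/(nz _ r)|] => w wr.
  rewrite /A Normc.normcM normcX Normc.normcM Normc.normcV c1 wr mul1r.
  have -> : D / 2 ^+ k = D * (r / 2) ^+ k * r^-1 ^+ k.
    rewrite -mulrA -exprMn -exprVn; congr (_ * _ ^+ _); field.
    by rewrite gt_eqF.
  by rewrite ler_wpM2r ?exprn_ge0 ?invr_ge0 ?(ltW r0)// gr.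
have bQ k : normc (circ (Q k) 2) <= 2 * tau * (2 * S / 2 ^+ k).
  apply: circ_bound => // w w2.
  rewrite /Q !Normc.normcM normcX Normc.normcM !Normc.normcV c1 w2 mul1r.
  have := normc_dist_ge w c; rewrite w2 c1 => h.
  have h' : 2 / normc (w - c) <= 2 by rewrite ler_pdivrMr; lra.
  rewrite (_ : 2 * S / 2 ^+ k = S * 2^-1 ^+ k * 2); last by rewrite exprVn; ring.
  apply: ler_pM => //; rewrite ?mulr_ge0 ?normc_ge0 ?exprn_ge0 ?invr_ge0 ?normc_ge0//.
  by rewrite ler_wpM2r ?exprn_ge0// gS.
have D0 : 0 <= D.
  have [r r0 /(_ (cis r 0))] := gD 0%N; rewrite normc_cis gtr0_norm// => /(_ erefl).
  by rewrite expr0 mulr1; apply: le_trans; exact: normc_ge0.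
(* Here [2 - 2 / 2 ^+ N] is the sum of [2 ^- k] over [k < N]. *)
have sum N : normc (circ (Q 0%N) 2) <= 2 * tau * (D * (2 - 2 / 2 ^+ N)) + normc (circ (Q N) 2).
  elim: N => [|N IH]; first by rewrite expr0 divr1 subrr !mulr0 add0r.
  apply: (le_trans IH); rewrite QS (le_trans (lerD (lexx _) (normc_leD _ _)))//.
  rewrite addrA lerD2r (le_trans (lerD (lexx _) (bA N)))//.
  rewrite le_eqVlt; apply/orP; left; apply/eqP; rewrite exprSr; field.
  by rewrite expf_neq0.
have S0 : 0 <= S.
  by apply: le_trans (gS (cis 2 0) _); rewrite ?normc_ge0// normc_cis ger0_norm.
have {sum} sum N : normc (g c) <= 4 * D + 4 * S / 2 ^+ N.
  have := le_trans (sum N) (lerD (lexx _) (bQ N)); rewrite Q0 Normc.normcM.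
  rewrite (_ : normc tau%:C%C = tau); last first.
    by rewrite /= expr0n addr0 sqrtr_sqr gtr0_norm.
  rewrite -[X in X + _](mulrA 2) -[X in _ + X](mulrA 2) !(mulrCA 2) -mulrDr ler_pM2l// => /le_trans; apply.
  have : 0 <= D * (2 / 2 ^+ N) by rewrite mulr_ge0// divr_ge0// exprn_ge0.
  rewrite (_ : 4 * S / 2 ^+ N = 2 * (2 * S / 2 ^+ N)); last ring.
  lra.
apply/ler_addgt0Pr => e e0.
have [N hN] : exists N : nat, 4 * S / 2 ^+ N < e.
  exists (Num.trunc (4 * S / e)).+1.
  rewrite ltr_pdivrMr ?exprn_gt0// -ltr_pdivrMl// mulrC.
  have := truncnS_gt (4 * S / e); set N := Num.trunc _.
  move=> /lt_le_trans; apply; rewrite -natrX ler_nat ltnW//; exact: ltn_expl.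
by have := sum N; lra.
Qed.

End EntireBound.

(** * Young conjugates and inductive limits *)

Section YoungConjugates.
Context {R : realType}.
Implicit Types (g h phi : R -> R).

(** On a set without upper bound [sup] is a default value, hence the hypothesis. *)
Lemma ler_young g x y : has_ubound [set x * y - g y | y in [set y | 0 <= y]] ->
  0 <= y -> x * y - g y <= young_conjugate g x.
Proof. by move=> ub y0; apply: ub_le_sup => //; exists y. Qed.

Lemma young_ler g x M : (forall y, 0 <= y -> x * y - g y <= M) ->
  young_conjugate g x <= M.
Proof.
move=> gM; apply: ge_sup; first by exists (x * 0 - g 0), 0 => /=.
by move=> _ [y y0 <-]; exact: gM.
Qed.

Variable phi : R -> R.
Hypothesis phi_nd : forall x y, 0 <= x -> x <= y -> phi x <= phi y.
Hypothesis phi_superlinear : phi x / x @[x --> +oo] --> +oo.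

Let psi_star := young_conjugate (psi phi).

(** Beyond a threshold [N], [y * x <= y * expR x <= phi (expR x)] by superlinearity; below it,
    [y * x <= y * N] and [phi] is at least [phi 0]. *)
Lemma young_psi_has_ubound y : 0 <= y ->
  has_ubound [set y * x - psi phi x | x in [set x | 0 <= x]].
Proof.
move=> y0; have /cvgryPge/(_ y)[M [_ HM]] := phi_superlinear.
pose N := Num.max M 0; exists (y * N + `|phi 0|) => _ [x x0 <-].
have N0 : 0 <= N by rewrite le_max lexx orbT.
have yN : 0 <= y * N by rewrite mulr_ge0.
have a0 := normr_ge0 (phi 0); have := ler_norm (- phi 0); rewrite normrN => a1.
have xe : x <= expR x by have := expR_ge1Dx x; lra.
have [xN|Nx] := leP (expR x) N.
  have : y * x <= y * N by rewrite ler_wpM2l// (le_trans xe).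
  have := phi_nd (lexx 0) (expR_ge0 x); rewrite /psi; lra.
have Mx : M < expR x by apply: le_lt_trans Nx; rewrite le_max lexx.
have := HM _ Mx; rewrite ler_pdivlMr ?expR_gt0// => h.
have : y * x <= y * expR x by rewrite ler_wpM2l.
rewrite /psi; lra.
Qed.

Lemma ler_young_psi x y : 0 <= y -> 0 <= x -> y * x - psi phi x <= psi_star y.
Proof. by move=> y0 x0; apply: ler_young => //; exact: young_psi_has_ubound. Qed.

(** Supplies the nearly optimal radius in the Cauchy estimates; the loss of 1 becomes a factor
    [expR 1]. *)
Lemma young_psi_adherent y : 0 <= y ->
  exists2 x, 0 <= x & psi_star y - 1 < y * x - psi phi x.
Proof.
move=> y0; have [] := @sup_adherent R [set y * x - psi phi x | x in [set x | 0 <= x]] 1 ltr01.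
  by split; [exists (y * 0 - psi phi 0), 0 => /=|exact: young_psi_has_ubound].
by move=> _ [x x0 <-] h; exists x.
Qed.

Lemma young_young_psi_has_ubound x : 0 <= x ->
  has_ubound [set x * y - psi_star y | y in [set y | 0 <= y]].
Proof.
move=> x0; exists (psi phi x) => _ [y y0 <-].
by have := ler_young_psi y0 x0; rewrite mulrC; lra.
Qed.

Lemma ler_young_young_psi x y : 0 <= x -> 0 <= y ->
  x * y - psi_star y <= young_conjugate psi_star x.
Proof. by move=> x0 y0; apply: ler_young => //; exact: young_young_psi_has_ubound. Qed.

Lemma young_young_psi_ler x : 0 <= x -> young_conjugate psi_star x <= psi phi x.
Proof.
move=> x0; apply: young_ler => y y0.
by have := ler_young_psi y0 x0; rewrite mulrC; lra.
Qed.

Lemma biconjugate_weight_ler t : 0 <= t -> biconjugate_weight phi t <= phi (1 + t).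
Proof.
move=> t0; rewrite (le_trans (young_young_psi_ler _)) ?ln_ge0 ?lerDl//.
by rewrite /psi lnK// posrE; lra.
Qed.

End YoungConjugates.

(** * Effect of the growth conditions on the conjugates *)

Section WeightComparison.
Context {R : realType}.
Variables phi phi' : R -> R.
Hypothesis phi_nd : forall x y, 0 <= x -> x <= y -> phi x <= phi y.
Hypothesis phi_superlinear : phi x / x @[x --> +oo] --> +oo.
Hypothesis phi'_nd : forall x y, 0 <= x -> x <= y -> phi' x <= phi' y.
Hypothesis phi'_superlinear : phi' x / x @[x --> +oo] --> +oo.

Lemma biconjugate_weight_doubling a : (forall x, 0 <= x -> phi (2 * x) <= phi' x + a) ->
  exists C : R, forall t, 0 <= t -> biconjugate_weight phi t <= phi' t + C.
Proof.
(* The constant [a] serves for [t > 1], where [1 + t <= 2 * t]; the other one serves for [t <= 1],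
   where [1 + t <= 2]. *)
move=> dbl; exists (Num.max a (phi 2 - phi' 0)) => t t0.
rewrite (le_trans (biconjugate_weight_ler _ _ t0))//.
have m1 : a <= Num.max a (phi 2 - phi' 0) by rewrite le_max lexx.
have m2 : phi 2 - phi' 0 <= Num.max a (phi 2 - phi' 0) by rewrite le_max lexx orbT.
have [t1|t1] := leP t 1.
  have : phi (1 + t) <= phi 2 by apply: phi_nd; lra.
  have := phi'_nd (lexx 0) t0; lra.
have : phi (1 + t) <= phi (2 * t) by apply: phi_nd; lra.
have := dbl _ t0; lra.
Qed.

(** Doubling the argument of [phi] translates [psi phi] by [ln 2]. The term [- y * ln 2] is the
    source of the factor [2 ^- j] in the Cauchy estimates. *)
Lemma young_psi_doubling a y : (forall x, 0 <= x -> phi (2 * x) <= phi' x + a) ->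
  0 <= y -> young_conjugate (psi phi') y <= young_conjugate (psi phi) y - y * ln 2 + a.
Proof.
move=> dbl y0; apply: young_ler => s s0.
have l2 : 0 <= ln 2 :> R by rewrite ln_ge0// ler1n.
have := ler_young_psi phi_nd phi_superlinear y0 (addr_ge0 s0 l2).
rewrite /psi expRD lnK ?posrE// [expR s * 2]mulrC.
have := dbl _ (expR_ge0 s); rewrite mulrDr; lra.
Qed.

(** Since [s <= ln (1 + expR s)], the logarithmic gain absorbs the extra term [k * s] in the
    supremum. *)
Lemma young_psi_log k C y : 0 <= k ->
  (forall x, 0 <= x -> phi x + k * ln (1 + x) <= phi' x + C) -> 0 <= y ->
  young_conjugate (psi phi') (y + k) <= young_conjugate (psi phi) y + C.
Proof.
move=> k0 log y0; apply: young_ler => s s0.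
have := ler_young_psi phi_nd phi_superlinear y0 s0.
have := log _ (expR_ge0 s); rewrite /psi mulrDl.
have : k * s <= k * ln (1 + expR s).
  rewrite ler_wpM2l// -[leLHS]expRK ler_ln ?posrE ?expR_gt0 ?addr_gt0 ?expR_gt0//.
  by rewrite lerDr.
lra.
Qed.

(** The logarithmic gain passes to the biconjugates: a competitor [y] for [phi] is compared with the
    competitor [y + k] for [phi']. *)
Lemma biconjugate_weight_log k C t : 0 <= k ->
  (forall x, 0 <= x -> phi x + k * ln (1 + x) <= phi' x + C) -> 0 <= t ->
  biconjugate_weight phi t + k * ln (1 + t) <= biconjugate_weight phi' t + C.
Proof.
move=> k0 log t0; rewrite -lerBrDr; apply: young_ler => y y0.
have l0 : 0 <= ln (1 + t) by rewrite ln_ge0// lerDl.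
have := young_psi_log k0 log y0.
have := ler_young_young_psi phi'_nd phi'_superlinear l0 (addr_ge0 y0 k0).
rewrite mulrDr -/(biconjugate_weight phi' t); lra.
Qed.

End WeightComparison.

(** * Comparison of weighted spaces and of their inductive limits *)

Section InductiveLimits.
Context {R : realType} {n : nat}.
Implicit Types (w : R -> R) (f : 'rV[R[i]]_n -> R[i]^o).

Definition weighted_value w k f z : R :=
  Normc.normc (f z) * (1 + norm_Cn z) ^+ k / expR (w (norm_Rn (Im_Cn z))).

(** Continuity of the inclusion of weighted spaces, with no loss in [k]; real bounds [M] replace the
    extended norms. *)
Definition dominated w w' := forall k, exists2 K : R, 0 < K &
  forall f (M : R), entire f -> (forall z, weighted_value w k f z <= M) ->
    forall z, weighted_value w' k f z <= K * M.

Lemma weighted_norm_le w k f (M : R) :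
  (weighted_norm w k f <= M%:E)%E <-> forall z, weighted_value w k f z <= M.
Proof.
split=> [fM z|fM].
  rewrite -lee_fin; apply: le_trans fM; apply: ereal_sup_ubound.
  by exists z.
by apply: ge_ereal_sup => _ [z _ <-]; rewrite lee_fin; exact: fM.
Qed.

Lemma weighted_norm_lty w k f :
  (weighted_norm w k f < +oo)%E <-> exists M : R, forall z, weighted_value w k f z <= M.
Proof.
split=> [foo|[M /weighted_norm_le fM]]; last by apply: le_lt_trans fM _; exact: ltry.
have : ((weighted_value w k f 0)%:E <= weighted_norm w k f)%E.
  by apply: ereal_sup_ubound; exists 0.
case E : (weighted_norm w k f) foo => [M| |] // _ _.
by exists M; apply/weighted_norm_le; rewrite E.
Qed.

Lemma dominated_weighted_space w w' : dominated w w' ->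
  weighted_space (n := n) w `<=` weighted_space w'.
Proof.
move=> ww' f fw k _; have [fe /weighted_norm_lty[M fM]] := fw k Logic.I.
split=> //; apply/weighted_norm_lty; have [K K0 H] := ww' k.
by exists (K * M); exact: H.
Qed.

Lemma dominated_weighted_union (w w' : nat -> R -> R) :
  (forall nu, exists mu, dominated (w nu) (w' mu)) ->
  weighted_union (n := n) w `<=` weighted_union w'.
Proof.
move=> ww' f [nu _ fnu]; have [mu /dominated_weighted_space H] := ww' nu.
by exists mu => //; exact: H.
Qed.

(** The same [T] and [iota] serve for both systems: a topology for which the inclusions of the [w']
    spaces are continuous has this property for the [w] spaces, each of which embeds continuously
    into some [w'] space. *)
Lemma dominated_weighted_union_open (w w' : nat -> R -> R) :
  (forall nu, exists mu, dominated (w nu) (w' mu)) ->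
  weighted_union (n := n) w = weighted_union w' ->
  weighted_union_open (n := n) w' `<=` weighted_union_open w.
Proof.
move=> ww' eqw U [T [iota [inj rng cont [A oA UA]]]].
exists T, iota; split => //; [by rewrite rng; exact: esym eqw| |by exists A].
move=> nu B oB; split=> [f []//|f [fnu iBf]].
have [mu dom] := ww' nu; have sub := dominated_weighted_space dom.
have [_ /(_ f (conj (sub f fnu) iBf))[k [e [e0 He]]]] := cont mu B oB.
have [K HK] := choice (fun k => let: ex_intro2 K K0 H := dom k in
  ex_intro (fun K : R => 0 < K /\ forall f (M : R), entire f ->
    (forall z, weighted_value (w nu) k f z <= M) ->
    forall z, weighted_value (w' mu) k f z <= K * M) K (conj K0 H)).
pose S := 1 + \sum_(j < k.+1) K j.
have S0 : 0 < S by rewrite ltr_pwDl// sumr_ge0// => j _; have [/ltW] := HK j.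
(* [S] dominates every [K j] with [j <= k]; the 2 makes the final inequality strict. *)
exists k, (e / (2 * S)); split; first by rewrite divr_gt0// mulr_gt0.
move=> g [gnu Hg]; split=> //.
apply: (He g _).2; split; first exact: sub.
move=> j jk; have [Kj0 HKj] := HK j.
apply: (@le_lt_trans _ _ (K j * (e / (2 * S)))%:E).
  apply/weighted_norm_le; apply: HKj; last exact/weighted_norm_le/ltW/Hg.
  have [ge _] := gnu 0%N Logic.I; have [fe _] := fnu 0%N Logic.I.
  by move=> z; apply: (@differentiableB _ _ _ g f); [exact: ge|exact: fe].
rewrite lte_fin mulrA ltr_pdivrMr ?mulr_gt0// mulrC ltr_pM2l//.
have : K j <= S.
  rewrite /S (bigD1 (Ordinal (jk : (j < k.+1)%N)))//=.
  have : 0 <= \sum_(i < k.+1 | i != Ordinal (jk : (j < k.+1)%N)) K i.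
    by rewrite sumr_ge0// => i _; have [/ltW] := HK i.
  lra.
lra.
Qed.

End InductiveLimits.

(** * Estimates in tubes *)

Section TubeEstimates.
Context {R : realType} {n : nat}.
Local Notation C := R[i].
Local Notation normc := (@Normc.normc R).
Implicit Types (u z : 'rV[C]_n).

Lemma norm_Cn_ge0 z : 0 <= norm_Cn z.
Proof. exact: sqrtr_ge0. Qed.

Lemma norm_Rn_ge0 (x : 'rV[R]_n) : 0 <= norm_Rn x.
Proof. exact: sqrtr_ge0. Qed.

Lemma normc_le_norm_Cn z i : normc (z ord0 i) <= norm_Cn z.
Proof.
rewrite /norm_Cn -[leLHS]ger0_norm ?normc_ge0// -sqrtr_sqr ler_wsqrtr//.
by rewrite (bigD1 i)//= lerDl sumr_ge0// => j _; rewrite sqr_ge0.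
Qed.

Lemma normr_le_norm_Rn (x : 'rV[R]_n) i : `|x ord0 i| <= norm_Rn x.
Proof.
rewrite /norm_Rn -sqrtr_sqr ler_wsqrtr//.
by rewrite (bigD1 i)//= lerDl sumr_ge0// => j _; rewrite sqr_ge0.
Qed.

Lemma norm_Cn_le_sum z : norm_Cn z <= \sum_i normc (z ord0 i).
Proof.
set S := \sum_i _; have S0 : 0 <= S by rewrite sumr_ge0// => i _; exact: normc_ge0.
rewrite -[leRHS]ger0_norm// -sqrtr_sqr ler_wsqrtr// expr2 {1}/S mulr_suml.
apply: ler_sum => i _; rewrite expr2 ler_wpM2l ?normc_ge0//.
rewrite /S (bigD1 i)//= lerDl sumr_ge0// => j _; exact: normc_ge0.
Qed.

(** Used to move the polynomial weight between [z], its real part and points of the complex line.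
    Working coordinatewise costs only the constant [n.+1]. *)
Lemma norm_Cn_prod_bound z a b : 0 <= a -> 0 <= b ->
  (forall i, normc (z ord0 i) <= a + b) ->
  1 + norm_Cn z <= n.+1%:R * ((1 + a) * (1 + b)).
Proof.
move=> a0 b0 zab; have ab0 := mulr_ge0 a0 b0.
have : norm_Cn z <= n%:R * (a + b).
  apply: (le_trans (norm_Cn_le_sum z)); apply: le_trans (ler_sum _ (fun i _ => zab i)) _.
  by rewrite sumr_const card_ord mulr_natl.
have : n%:R * (a + b) <= n%:R * ((1 + a) * (1 + b)) by rewrite ler_wpM2l//; lra.
rewrite -natr1 mulrDl mul1r; lra.
Qed.

Lemma norm_RnZ (c : R) (x : 'rV[R]_n) : norm_Rn (c *: x) = `|c| * norm_Rn x.
Proof.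
rewrite /norm_Rn -sqrtr_sqr -sqrtrM ?sqr_ge0// mulr_sumr; congr Num.sqrt.
by apply: eq_bigr => i _; rewrite mxE exprMn.
Qed.

Definition real_vec (x : 'rV[R]_n) : 'rV[C]_n := map_mx (fun t => t%:C%C) x.
Definition Re_Cn z : 'rV[R]_n := map_mx (@complex.Re R) z.

Lemma Re_Im_Cn z : z = real_vec (Re_Cn z) + 'i%C *: real_vec (Im_Cn z).
Proof. by apply/rowP => i; rewrite !mxE -complexE. Qed.

(** Hence the circle of radius [r] in the variable [w] is mapped into the tube where the imaginary
    part has norm at most [r * norm_Rn y]. *)
Lemma Im_Cn_line (x y : 'rV[R]_n) (w : C) :
  Im_Cn (real_vec x + w *: real_vec y) = (@complex.Im R w) *: y.
Proof.
apply/rowP => i; rewrite !mxE; case: w => a b /=; ring.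
Qed.

Lemma derivable_line (f : 'rV[C]_n -> C^o) (u v : 'rV[C]_n) (w : C^o) : entire f ->
  derivable (fun w : C^o => f (u + w *: v) : C^o) w 1.
Proof.
move=> fe; apply/derivable1_diffP.
apply: (@differentiable_comp _ _ _ _ (fun w : C^o => u + w *: v) f); last exact: fe.
apply: differentiableD; first exact: differentiable_cst.
by apply: differentiableZl; exact/derivable1_diffP/derivable_id.
Qed.

Lemma weighted_value_ge0 (w : R -> R) k (f : 'rV[C]_n -> C^o) z :
  0 <= weighted_value w k f z.
Proof.
rewrite divr_ge0 ?expR_ge0// mulr_ge0 ?normc_ge0//.
by rewrite exprn_ge0// addr_ge0// norm_Cn_ge0.
Qed.

(** * Mutual domination of the two families of weights *)

Section Domination.
Variable phi : nat -> R -> R.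
Hypothesis phi_nd : forall m (x y : R), 0 <= x -> x <= y -> phi m x <= phi m y.
Hypothesis i1 : forall m, phi m x / x @[x --> +oo] --> +oo.
Hypothesis i2 : forall m (A : R), 0 < A -> exists2 C : R, 0 < C &
  forall x : R, 0 <= x -> phi m x + A * ln (1 + x) <= phi m.+1 x + C.
Hypothesis i3 : forall m, exists2 a : R, 0 < a &
  forall x : R, 0 <= x -> phi m (2 * x) <= phi m.+1 x + a.

(** The exponent [k.+1] instead of [k] is positive even for [k = 0], as (i2) demands. *)
Lemma pow_le_expR (x : R) (k : nat) : 0 <= x ->
  (1 + x) ^+ k <= expR (k.+1%:R * ln (1 + x)).
Proof.
move=> x0; rewrite expRM_natl lnK ?posrE; last lra.
by rewrite exprSr ler_peMr// ?exprn_ge0 ?lerDl//; lra.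
Qed.

Lemma dominated_biconjugate_phi m :
  dominated (n := n) (biconjugate_weight (phi m)) (phi m.+1).
Proof.
have [a a0 dbl] := i3 m.
have [c Hc] := biconjugate_weight_doubling (phi_nd m) (i1 m) (phi_nd m.+1) dbl.
move=> k; exists (expR c) => [|f M fe fM z]; first exact: expR_gt0.
have t0 := norm_Rn_ge0 (Im_Cn z).
have M0 : 0 <= M := le_trans (weighted_value_ge0 _ k f z) (fM z).
have := fM z; rewrite /weighted_value !ler_pdivrMr ?expR_gt0// => /le_trans; apply.
by rewrite [leRHS]mulrAC -expRD [leRHS]mulrC ler_wpM2l// ler_expR addrC Hc// norm_Rn_ge0.
Qed.

(** The index moves three times: (i2) absorbs the weight lost on the circles, (i3) provides the
    factor [2 ^- j], and (i2) again absorbs the weight between the real part and [z]. *)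
Lemma dominated_phi_biconjugate m :
  dominated (n := n) (phi m) (biconjugate_weight (phi m.+3)).
Proof.
move=> k.
have k10 : 0 < k.+1%:R :> R by rewrite ltr0n.
have [C1 _ H1] := i2 m k10.
have [a _ dbl] := i3 m.+1.
have [C2 _ H2] := i2 m.+2 k10.
pose b t := biconjugate_weight (phi m.+2) t.
pose b' t := biconjugate_weight (phi m.+3) t.
have bb' t : 0 <= t -> (1 + t) ^+ k * expR (b t) <= expR C2 * expR (b' t).
  move=> t0; have := @biconjugate_weight_log _ _ _ (phi_nd _) (@i1 _) (@phi_nd _) (@i1 _) _ _ _ (ltW k10) H2 t0.
  rewrite -(ler_expR _ (_ + C2)) !expRD [leRHS]mulrC => /(le_trans _); apply.
  by rewrite mulrC ler_wpM2l ?expR_ge0// pow_le_expR.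
pose K1 := 4 * (n.+1%:R ^+ k * expR C1 * expR (1 + a)) * n.+1%:R ^+ k * expR C2.
pose K0 := expR (phi m 0 - b' 0).
have K10 : 0 < K1 by rewrite !mulr_gt0 ?exprn_gt0 ?ltr0n ?expR_gt0.
exists (K1 + K0) => [|f M fe fM z]; first by rewrite addr_gt0 ?expR_gt0.
have M0 : 0 <= M.
  exact: le_trans (weighted_value_ge0 _ k f z) (fM z).
have {}fM u : normc (f u) * (1 + norm_Cn u) ^+ k <= M * expR (phi m (norm_Rn (Im_Cn u))).
  by rewrite -ler_pdivrMr ?expR_gt0//; exact: fM.
rewrite /weighted_value ler_pdivrMr ?expR_gt0// -/(b' _).
set x := Re_Cn z; set y := Im_Cn z; set t := norm_Rn y.
have t0 : 0 <= t := norm_Rn_ge0 y.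
pose X := 1 + norm_Cn (real_vec x).
have X0 : 0 < X by rewrite ltr_pwDl// norm_Cn_ge0.
have Xk0 : 0 < X ^+ k by rewrite exprn_gt0.
have n0 : 0 < n.+1%:R :> R by rewrite ltr0n.
(* For [t = 0] the complex line degenerates to a point; the two weights are then compared at 0,
   which is what [K0] is for. *)
have [tz|tN0] := eqVneq t 0.
  apply: (le_trans (fM z)); rewrite -/y -/t tz.
  rewrite -[phi m 0](subrK (b' 0)) expRD -/K0 mulrA.
  by rewrite ler_wpM2r ?expR_ge0// [leLHS]mulrC ler_wpM2r// lerDr ltW.
have {tN0} tp : 0 < t by rewrite lt_neqAle eq_sym tN0.
pose g w := f (real_vec x + w *: real_vec y).
(* The division by [X ^+ k] keeps the decay in the real part of [z] throughout the one-variable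
   argument. *)
pose M' := M * (n.+1%:R ^+ k * expR C1) / X ^+ k.
have M'0 : 0 <= M' by rewrite !mulr_ge0 ?exprn_ge0 ?expR_ge0 ?invr_ge0 ?exprn_ge0 ?(ltW X0) ?(ltW n0).
have gle w r : normc w = r -> normc (g w) <= M' * expR (phi m.+1 (r * t)).
  move=> wr; have r0 : 0 <= r by rewrite -wr normc_ge0.
  set u := real_vec x + w *: real_vec y; have := fM u.
  rewrite Im_Cn_line norm_RnZ => fu.
  have rt0 : 0 <= r * t by rewrite mulr_ge0.
  have imt : `|complex.Im w| * t <= r * t by rewrite ler_wpM2r// -wr normr_Im.
  have {}fu : normc (g w) * (1 + norm_Cn u) ^+ k <= M * expR (phi m (r * t)).
    apply: (le_trans fu); rewrite ler_wpM2l// ler_expR phi_nd// mulr_ge0//.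
  (* The weight at [u] is traded for the weight at the real part [x], at the cost of [1 + r * t]. *)
  have Xu : X <= n.+1%:R * ((1 + norm_Cn u) * (1 + r * t)).
    apply: norm_Cn_prod_bound => [|//|i]; first exact: norm_Cn_ge0.
    have -> : real_vec x ord0 i = u ord0 i - w * (y ord0 i)%:C%C.
      by rewrite !mxE addrK.
    rewrite (le_trans (normc_leB _ _))//; apply: lerD; first exact: normc_le_norm_Cn.
    rewrite Normc.normcM wr ler_wpM2l// (le_trans (normc_leReIm _))//= normr0 addr0.
    exact: normr_le_norm_Rn.
  have Xuk : X ^+ k <= n.+1%:R ^+ k * ((1 + norm_Cn u) ^+ k * (1 + r * t) ^+ k).
    by rewrite -!exprMn lerXn2r ?nnegrE ?(ltW X0)// (le_trans (ltW X0) Xu).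
  have := H1 _ rt0; rewrite -(ler_expR _ (_ + C1)) !expRD => h1.
  rewrite /M' mulrAC ler_pdivlMr// (le_trans (ler_wpM2l (normc_ge0 _) Xuk))//.
  rewrite (_ : _ * (_ * _) = n.+1%:R ^+ k * (normc (g w) * (1 + norm_Cn u) ^+ k * (1 + r * t) ^+ k)); last ring.
  rewrite (_ : M * _ * _ = n.+1%:R ^+ k * (M * (expR (phi m.+1 (r * t)) * expR C1))); last ring.
  rewrite ler_wpM2l ?exprn_ge0 ?(ltW n0)//.
  apply: (@le_trans _ _ (M * expR (phi m (r * t)) * (1 + r * t) ^+ k)).
    by rewrite ler_wpM2r// exprn_ge0// addr_ge0.
  rewrite -mulrA ler_wpM2l//; apply: le_trans h1.
  by rewrite ler_wpM2l ?expR_ge0// pow_le_expR.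
pose D := M' * expR (1 + a) * expR (b t).
have gi : normc (g 'i%C) <= 4 * D.
  clearbody M'; apply: (@entire_bound _ g _ D (M' * expR (phi m.+1 (2 * t)))).
  - by move=> w; exact: derivable_line.
  - by rewrite /= expr0n add0r expr1n sqrtr1.
  - by move=> w /gle.
  move=> j; have j0 : 0 <= j%:R :> R by rewrite ler0n.
  have [s s0 Hs] := young_psi_adherent (phi_nd m.+1) (@i1 _) j0.
  (* With this radius [r * t = expR s], so [phi] on the circle is [psi] at the nearly optimal
     [s]. *)
  exists (expR s / t) => [|w /gle]; first by rewrite divr_gt0 ?expR_gt0.
  rewrite divfK ?gt_eqF// => /le_trans; apply.
  rewrite /D -!mulrA ler_wpM2l// exprMn -expRM_natl.
  have l0 : 0 <= ln (1 + t) by rewrite ln_ge0// lerDl.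
  have Hb : ln (1 + t) * j%:R - young_conjugate (psi (phi m.+2)) j%:R <= b t.
    by apply: (ler_young_young_psi (phi_nd m.+2) (@i1 _)).
  have Hd := young_psi_doubling (phi_nd _) (@i1 _) dbl j0.
  (* Replacing [t] by [1 + t] only strengthens the bound, and it yields the point [ln (1 + t) >= 0]
     at which the biconjugate is evaluated. *)
  have tj : expR (- (j%:R * (ln 2 + ln (1 + t)))) <= (t^-1 / 2) ^+ j.
    rewrite -mulrN expRM_natl expRN lerXn2r ?nnegrE ?invr_ge0 ?expR_ge0 ?divr_ge0 ?invr_ge0//.
    rewrite expRD !lnK ?posrE//; last lra.
    by rewrite -invfM lef_pV2 ?posrE ?mulr_gt0//; lra.
  have e0 : 0 <= expR (1 + a) * expR (b t) * expR (j%:R * s) by rewrite !mulr_ge0 ?expR_ge0.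
  rewrite !mulrA; apply: le_trans (ler_wpM2l e0 tj).
  rewrite -!expRD ler_expR; move: Hs Hb Hd; rewrite /psi; lra.
have zX : (1 + norm_Cn z) ^+ k <= n.+1%:R ^+ k * (X ^+ k * (1 + t) ^+ k).
  rewrite -!exprMn lerXn2r ?nnegrE ?addr_ge0 ?norm_Cn_ge0//.
    by rewrite !mulr_ge0 ?addr_ge0 ?norm_Cn_ge0.
  apply: norm_Cn_prod_bound => // [|i]; first exact: norm_Cn_ge0.
  have -> : z ord0 i = real_vec x ord0 i + 'i%C * (y ord0 i)%:C%C.
    by rewrite {1}(Re_Im_Cn z) !mxE.
  rewrite (le_trans (normc_leD _ _))//; apply: lerD; first exact: normc_le_norm_Cn.
  rewrite Normc.normcM (_ : normc 'i%C = 1) ?mul1r; last by rewrite /= expr0n add0r expr1n sqrtr1.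
  rewrite (le_trans (normc_leReIm _))//= normr0 addr0.
  exact: normr_le_norm_Rn.
have gz : g 'i%C = f z by rewrite /g -Re_Im_Cn.
rewrite gz in gi.
apply: (@le_trans _ _ (4 * D * (n.+1%:R ^+ k * (X ^+ k * (1 + t) ^+ k)))).
  apply: ler_pM => //; first exact: normc_ge0.
  by rewrite exprn_ge0// addr_ge0// norm_Cn_ge0.
apply: (@le_trans _ _ (K1 * M * expR (b' t))); last first.
  by rewrite ler_wpM2r ?expR_ge0// ler_wpM2r// lerDl expR_ge0.
rewrite (_ : K1 * M * _ = 4 * (M * (n.+1%:R ^+ k * expR C1) * expR (1 + a)) * n.+1%:R ^+ k * (expR C2 * expR (b' t))); last by rewrite /K1; ring.
rewrite [leLHS](_ : _ = 4 * (M * (n.+1%:R ^+ k * expR C1) * expR (1 + a)) * n.+1%:R ^+ k * ((1 + t) ^+ k * expR (b t))); last first.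
  by rewrite /D /M'; field; rewrite gt_eqF.
by rewrite ler_wpM2l ?bb'// !mulr_ge0 ?exprn_ge0 ?expR_ge0 ?(ltW n0).
Qed.

End Domination.
End TubeEstimates.

Theorem proposition1 (R : realType) (n : nat) (n_gt0 : (0 < n)%N)
    (phi : nat -> R -> R)
    (phi_nondecreasing : forall m (x y : R),
      0 <= x -> x <= y -> phi m x <= phi m y)
    (phi_continuous : forall m,
      {within [set x : R | 0 <= x], continuous (phi m)})
    (i1 : forall m, phi m x / x @[x --> +oo] --> +oo)
    (i2 : forall m (A : R), 0 < A -> exists2 C : R, 0 < C &
      forall x : R, 0 <= x -> phi m x + A * ln (1 + x) <= phi m.+1 x + C)
    (i3 : forall m, exists2 a : R, 0 < a &
      forall x : R, 0 <= x -> phi m (2 * x) <= phi m.+1 x + a) :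
  E_Phi n phi = H_Phi n phi /\ E_Phi_open n phi = H_Phi_open n phi.
Proof.
have EH nu : exists mu, dominated (n := n) (phi nu) (biconjugate_weight (phi mu)).
  by exists nu.+3; exact: dominated_phi_biconjugate.
have HE nu : exists mu, dominated (n := n) (biconjugate_weight (phi nu)) (phi mu).
  by exists nu.+1; exact: dominated_biconjugate_phi.
have E : E_Phi n phi = H_Phi n phi.
  by apply/seteqP; split; exact: dominated_weighted_union.
split; first exact: E.
apply/seteqP; split.
  (* Open sets pass in the direction opposite to the embeddings: this inclusion uses [HE], the next
     one [EH]. *)
  by apply: dominated_weighted_union_open => //; exact: esym E.
exact: dominated_weighted_union_open.
Qed.
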